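(* Let $A$ and $B$ be right faithfully flat $H$-Galois extensions, connected by a strict $H$-Morita context $(A,B,M,N,\alpha,\beta)$, and let $X,Y$ be right $A$-modules. Then the map $$\phi:\ {\rm Hom}_{A^{{\rm co}H}}(X,Y)\to{\rm Hom}_{B^{{\rm co}H}}(X\otimes_{A^{{\rm co}H}}M^{{\rm co}H},\ Y\otimes_{A^{{\rm co}H}}M^{{\rm co}H}),\quad\phi(f)=f\otimes_{A^{{\rm co}H}}M^{{\rm co}H},$$ preserves the Miyashita-Ulbrich action, i.e. $\phi(f)\leftharpoonup h=\phi(f\leftharpoonup h)$ for all $f\in{\rm Hom}_{A^{{\rm co}H}}(X,Y)$ and $h\in H$.
   Context: $k$ is a commutative ring; $H$ is a Hopf algebra over $k$, projective as a $k$-module, with bijective antipode $S$; $\otimes=\otimes_k$. Right coactions: $\rho(m)=m_{[0]}\otimes m_{[1]}$; $M^{{\rm co}H}=\{m\mid\rho(m)=m\otimes1\}$. A right $H$-comodule algebra $A$ is a right faithfully flat $H$-Galois extension (of $A^{{\rm co}H}$) if $A$ is faithfully flat as a right $A^{{\rm co}H}$-module and ${\rm can}':A\otimes_{A^{{\rm co}H}}A\to A\otimes H$, ${\rm can}'(a\otimes b)=a_{[0]}b\otimes a_{[1]}$, is bijective; equivalently ${\rm can}(a\otimes b)=ab_{[0]}\otimes b_{[1]}$ is bijective. Then $A\otimes_{A^{{\rm co}H}}M^{{\rm co}H}\to M$, $a\otimes m\mapsto am$, is an isomorphism for every $M\in{}_A\mathcal{M}^H$ (left $A$-modules with right $H$-coaction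 satisfying $\rho(am)=a_{[0]}m_{[0]}\otimes a_{[1]}m_{[1]}$). ${}_A\mathcal{M}_B^H$: $(A,B)$-bimodules with right $H$-coaction satisfying $\rho(amb)=a_{[0]}m_{[0]}b_{[0]}\otimes a_{[1]}m_{[1]}b_{[1]}$, with $A$-linear, $B$-linear, $H$-colinear maps; tensor products $M\otimes_BN$ carry the coaction $m_{[0]}\otimes n_{[0]}\otimes m_{[1]}n_{[1]}$. A strict $H$-Morita context $(A,B,M,N,\alpha,\beta)$ consists of $M\in{}_A\mathcal{M}_B^H$, $N\in{}_B\mathcal{M}_A^H$ and isomorphisms $\alpha:M\otimes_BN\to A$ in ${}_A\mathcal{M}_A^H$, $\beta:N\otimes_AM\to B$ in ${}_B\mathcal{M}_B^H$ with $\alpha(m\otimes n)m'=m\beta(n\otimes m')$, $\beta(n\otimes m)n'=n\alpha(m\otimes n')$. Miyashita-Ulbrich action: for $A$ right faithfully flat $H$-Galois and $h\in H$, write ${\rm can}^{-1}(1\otimes h)=\sum_il_i(h)\otimes_{A^{{\rm co}H}}r_i(h)$. For an $(A,A)$-bimodule $W$, $W^{A^{{\rm co}H}}=\{w\mid aw=wa\ \forall a\in A^{{\rm co}H}\}$ is a right $H$-module via $w\leftharpoonup h=\sum_il_i(h)wr_i(h)$. For right $A$-modules $X,Y$, ${\rm Hom}(X,Y)={\rm Hom}_k(X,Y)$ is an $(A,A)$-bimodule via $(a\cdot f\cdot a')(x)=f(xa)a'$, so ${\rm Hom}(X,Y)^{A^{{\rm co}H}}={\rm Hom}_{A^{{\rm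 co}H}}(X,Y)$ and $(f\leftharpoonup h)(x)=\sum_if(xl_i(h))r_i(h)$. Likewise for $B$. For a right $A$-module $X$, $X\otimes_{A^{{\rm co}H}}M^{{\rm co}H}$ is a right $B$-module by transporting the right $B$-action of $X\otimes_AM$ along the isomorphism $X\otimes_{A^{{\rm co}H}}M^{{\rm co}H}\to X\otimes_AM$, $x\otimes m\mapsto x\otimes_Am$. The target of $\phi$ carries the resulting Miyashita-Ulbrich action for $B$. *)

(* Defs.v *)
From HB Require Import structures.
From mathcomp Require Import all_boot all_algebra.
From mathcomp Require Import boolp classical_sets.

Set Implicit Arguments.
Unset Strict Implicit.
Unset Printing Implicit Defensive.

Import GRing.Theory.
Local Open Scope ring_scope.
Local Open Scope quotient_scope.

(* Balanced tensor products.  [tens ra la] is the abelian group generated by  *)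
(* symbols x (x) y, additive in x and in y, modulo                            *)
(*             (x . i) (x) y = x (x) (i . y)     for every scalar i,          *)
(* where [ra i x] stands for x . i and [la i y] for i . y.  It is built as a  *)
(* quotient of the finite formal sums (sequences of pairs); the opposite of a *)
(* sum is obtained by negating the left components.                           *)

Section Tensor.
Variables (I : Type) (X Y : zmodType) (ra : I -> X -> X) (la : I -> Y -> Y).

Inductive tens_eq : seq (X * Y) -> seq (X * Y) -> Prop :=
| te_refl s : tens_eq s s
| te_sym s t : tens_eq s t -> tens_eq t s
| te_trans s t u : tens_eq s t -> tens_eq t u -> tens_eq s u
| te_cat s s' t t' : tens_eq s s' -> tens_eq t t' -> tens_eq (s ++ t) (s' ++ t')
| te_swap s t : tens_eq (s ++ t) (t ++ s)
| te_addl x x' y : tens_eq [:: (x + x', y)] [:: (x, y); (x', y)]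
| te_addr x y y' : tens_eq [:: (x, y + y')] [:: (x, y); (x, y')]
| te_zero y : tens_eq [:: (0, y)] [::]
| te_bal i x y : tens_eq [:: (ra i x, y)] [:: (x, la i y)].

Definition tens_eqb (s t : seq (X * Y)) : bool := `[< tens_eq s t >].

Lemma tens_eqb_equiv : equiv_class_of tens_eqb.
Proof.
split=> [s|s t|t s u].
- by apply/asboolP; apply: te_refl.
- by apply/asboolP/asboolP; apply: te_sym.
- by move=> /asboolP h1 /asboolP h2; apply/asboolP; apply: te_trans h1 h2.
Qed.

Canonical tens_equivrel := EquivRelPack tens_eqb_equiv.

Definition tens : Type := {eq_quot tens_eqb}.
HB.instance Definition _ := Choice.on tens.
HB.instance Definition _ := EqQuotient.on tens.

Definition tsum (s : seq (X * Y)) : tens := \pi_tens s.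
Definition tpair (x : X) (y : Y) : tens := tsum [:: (x, y)].

Lemma tsumP s t : tsum s = tsum t <-> tens_eq s t.
Proof.
split=> [/eqP|h].
  by rewrite /tsum eqmodE => /asboolP.
by apply/eqP; rewrite /tsum eqmodE; apply/asboolP.
Qed.

Lemma tsum_repr (t : tens) : tsum (repr t) = t.
Proof. by rewrite /tsum reprK. Qed.

Definition tneg (s : seq (X * Y)) := [seq (- p.1, p.2) | p <- s].

Lemma tneg_cancel s : tens_eq (tneg s ++ s) [::].
Proof.
elim: s => [|[x y] s ih] /=; first exact: te_refl.
have h : tens_eq ([:: (- x, y)] ++ [:: (x, y)]) [::].
  apply: te_trans (te_zero y).
  by rewrite -(addNr x); apply/te_sym/te_addl.
have h2 : tens_eq (tneg s ++ [:: (x, y)] ++ s) ([:: (x, y)] ++ tneg s ++ s).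
  by rewrite !catA; apply: te_cat (te_swap _ _) (te_refl _).
apply: (te_trans (te_cat (te_refl [:: (- x, y)]) h2)).
by rewrite catA; apply: te_cat h ih.
Qed.

Lemma tneg_eq s t : tens_eq s t -> tens_eq (tneg s) (tneg t).
Proof.
move=> st.
have h1 : tens_eq (tneg s ++ t) [::].
  apply: te_trans (tneg_cancel s).
  exact: te_cat (te_refl _) (te_sym st).
have h2 : tens_eq (t ++ tneg t) [::] := te_trans (te_swap _ _) (tneg_cancel t).
have h3 : tens_eq (tneg s) (tneg s ++ t ++ tneg t).
  by rewrite -[X in tens_eq X _]cats0; apply: te_cat (te_refl _) (te_sym h2).
apply: (te_trans h3); rewrite catA.
exact: te_cat h1 (te_refl (tneg t)).
Qed.

Definition tadd (s t : tens) : tens := tsum (repr s ++ repr t).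
Definition topp (s : tens) : tens := tsum (tneg (repr s)).

Lemma repr_tsum s : tens_eq (repr (tsum s)) s.
Proof. by apply/tsumP; rewrite tsum_repr. Qed.

Lemma tadd_tsum s t : tadd (tsum s) (tsum t) = tsum (s ++ t).
Proof. by apply/tsumP; apply: te_cat; apply: repr_tsum. Qed.

Lemma topp_tsum s : topp (tsum s) = tsum (tneg s).
Proof. by apply/tsumP; apply/tneg_eq/repr_tsum. Qed.

Lemma taddA : associative tadd.
Proof.
move=> s t u; rewrite -[s]tsum_repr -[t]tsum_repr -[u]tsum_repr.
by rewrite !tadd_tsum catA.
Qed.

Lemma taddC : commutative tadd.
Proof.
move=> s t; rewrite -[s]tsum_repr -[t]tsum_repr !tadd_tsum.
by apply/tsumP/te_swap.
Qed.

Lemma tadd0 : left_id (tsum [::]) tadd.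
Proof. by move=> s; rewrite -[s]tsum_repr tadd_tsum. Qed.

Lemma taddN : left_inverse (tsum [::]) topp tadd.
Proof.
move=> s; rewrite -[s]tsum_repr topp_tsum tadd_tsum.
by apply/tsumP/tneg_cancel.
Qed.

HB.instance Definition _ := GRing.isZmodule.Build tens taddA taddC tadd0 taddN.

Lemma tsum_cat s t : tsum (s ++ t) = tsum s + tsum t.
Proof. by rewrite -[RHS]/(tadd _ _) tadd_tsum. Qed.

Lemma tsumE s : tsum s = \sum_(p <- s) tpair p.1 p.2.
Proof.
elim: s => [|[x y] s ih]; first by rewrite big_nil.
by rewrite big_cons -ih -[RHS]tsum_cat.
Qed.

Lemma tpairDl x x' y : tpair (x + x') y = tpair x y + tpair x' y.
Proof. by rewrite -tsum_cat; apply/tsumP/te_addl. Qed.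

Lemma tpairDr x y y' : tpair x (y + y') = tpair x y + tpair x y'.
Proof. by rewrite -tsum_cat; apply/tsumP/te_addr. Qed.

Lemma tpair_bal i x y : tpair (ra i x) y = tpair x (la i y).
Proof. by apply/tsumP/te_bal. Qed.

Lemma tens_ind (P : tens -> Prop) :
  P 0 -> (forall x y, P (tpair x y)) -> (forall s t, P s -> P t -> P (s + t)) ->
  forall t, P t.
Proof.
move=> P0 P1 PD t; rewrite -[t]tsum_repr tsumE.
by elim: (repr t) => [|p s ih]; rewrite ?big_nil // big_cons; apply: PD.
Qed.

(* [tlift g t] is  \sum_i g x_i y_i  for a chosen expression                  *)
(* t = \sum_i x_i (x) y_i.  It does not depend on that choice as soon as g is *)
(* balanced: [tlift g] is then the additive map induced by g.  This is also   *)
(* how Sweedler's notation is rendered: \sum g(h_1, h_2) = tlift g (Delta h). *)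
Definition tlift (Z : zmodType) (g : X -> Y -> Z) (t : tens) : Z :=
  \sum_(p <- repr t) g p.1 p.2.

Record balanced (Z : zmodType) (g : X -> Y -> Z) : Prop := Balanced {
  balDl : forall x x' y, g (x + x') y = g x y + g x' y;
  balDr : forall x y y', g x (y + y') = g x y + g x y';
  balE : forall i x y, g (ra i x) y = g x (la i y) }.

Section Lift.
Variables (Z : zmodType) (g : X -> Y -> Z).
Hypothesis gb : balanced g.

Lemma tlift_tsum s : tlift g (tsum s) = \sum_(p <- s) g p.1 p.2.
Proof.
have key s1 s2 : tens_eq s1 s2 ->
    \sum_(p <- s1) g p.1 p.2 = \sum_(p <- s2) g p.1 p.2.
  elim=> {s1 s2} //.
  - by move=> s1 t u _ -> _ ->.
  - by move=> s1 s' t t' _ h _ h'; rewrite !big_cat /= h h'.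
  - by move=> s1 t; rewrite !big_cat /= addrC.
  - by move=> x x' y; rewrite !big_cons !big_nil /= (balDl gb) !addr0.
  - by move=> x y y'; rewrite !big_cons !big_nil /= (balDr gb) !addr0.
  - move=> y; rewrite big_cons !big_nil /= addr0.
    by apply: (addrI (g 0 y)); rewrite -(balDl gb) !addr0.
  - by move=> i x y; rewrite !big_cons !big_nil /= (balE gb).
by apply: key; apply: repr_tsum.
Qed.

Lemma tlift_tpair x y : tlift g (tpair x y) = g x y.
Proof. by rewrite tlift_tsum big_cons big_nil addr0. Qed.

Lemma tliftD s t : tlift g (s + t) = tlift g s + tlift g t.
Proof.
rewrite -[s]tsum_repr -[t]tsum_repr -tsum_cat !tlift_tsum.
by rewrite big_cat.
Qed.

Lemma tlift0 : tlift g 0 = 0.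
Proof. by apply: (addrI (tlift g 0)); rewrite -tliftD !addr0. Qed.

Lemma tliftN t : tlift g (- t) = - tlift g t.
Proof. by apply: (addrI (tlift g t)); rewrite -tliftD !subrr tlift0. Qed.

End Lift.

End Tensor.

(* Tensor product over the commutative ring k.                                *)

Section KTensor.
Variables (k : comPzRingType).

Definition ktens (X Y : lmodType k) : Type :=
  tens (fun (c : k) (x : X) => c *: x) (fun (c : k) (y : Y) => c *: y).
HB.instance Definition _ (X Y : lmodType k) := GRing.Zmodule.on (ktens X Y).

Definition kpair (X Y : lmodType k) (x : X) (y : Y) : ktens X Y := tpair _ _ x y.

Section Scale.
Variables X Y : lmodType k.

Definition kscale (c : k) (t : ktens X Y) : ktens X Y :=
  tlift (fun x y => kpair (c *: x) y) t.

Lemma kscale_bal c : balanced (fun (c : k) (x : X) => c *: x)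
  (fun (c : k) (y : Y) => c *: y) (fun x y => kpair (c *: x) y).
Proof.
split=> [x x' y|x y y'|d x y].
- by rewrite scalerDr; apply: tpairDl.
- exact: tpairDr.
- rewrite scalerA mulrC -scalerA; exact: tpair_bal.
Qed.

Lemma kscaleE c x y : kscale c (kpair x y) = kpair (c *: x) y.
Proof. exact: (tlift_tpair (kscale_bal c)). Qed.

Lemma kscaleDr : right_distributive kscale +%R.
Proof. by move=> c s t; apply: (tliftD (kscale_bal c)). Qed.

Lemma kscale_0 c : kscale c 0 = 0.
Proof. exact: (tlift0 (kscale_bal c)). Qed.

Lemma kscaleA c d t : kscale c (kscale d t) = kscale (c * d) t.
Proof.
elim/(@tens_ind k X Y): t => [|x y|s t hs ht]; first by rewrite !kscale_0.
  by rewrite !kscaleE scalerA.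
by rewrite !kscaleDr hs ht.
Qed.

Lemma kscale1 : left_id 1 kscale.
Proof.
elim/(@tens_ind k X Y) => [|x y|s t hs ht]; first by rewrite !kscale_0.
  by rewrite kscaleE scale1r.
by rewrite kscaleDr hs ht.
Qed.

Lemma kscaleDl t : {morph kscale^~ t : c d / c + d}.
Proof.
move=> c d /=; elim/(@tens_ind k X Y): t => [|x y|s t hs ht].
- by rewrite !kscale_0 addr0.
- by rewrite !kscaleE scalerDl; apply: tpairDl.
- by rewrite !kscaleDr hs ht addrACA.
Qed.

HB.instance Definition _ := GRing.Zmodule_isLmodule.Build k (ktens X Y)
  kscaleA kscale1 kscaleDr kscaleDl.

End Scale.

Definition tmap (X X' Y Y' : lmodType k) (f : X -> X') (g : Y -> Y')
    (t : ktens X Y) : ktens X' Y' :=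
  tlift (fun x y => kpair (f x) (g y)) t.

Definition tmap2 (X1 X2 X Y1 Y2 Y : lmodType k)
    (f : X1 -> X2 -> X) (g : Y1 -> Y2 -> Y)
    (s : ktens X1 Y1) (t : ktens X2 Y2) : ktens X Y :=
  tlift (fun x1 y1 => tlift (fun x2 y2 => kpair (f x1 x2) (g y1 y2)) t) s.

Definition tassoc (X Y Z : lmodType k) (t : ktens (ktens X Y) Z) :
    ktens X (ktens Y Z) :=
  tlift (fun s z => tlift (fun x y => kpair x (kpair y z)) s) t.

End KTensor.

Notation "x ⊗ y" := (kpair x y) (at level 40, left associativity) : ring_scope.

HB.mixin Record isHopf (k : comPzRingType) H of GRing.Algebra k H := {
  Delta : H -> ktens H H;
  counit : H -> k;
  antipode : H -> H;
  Delta_linear : forall (c : k) (g h : H),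
    Delta (c *: g + h) = c *: Delta g + Delta h;
  Delta_1 : Delta 1 = 1 ⊗ 1;
  Delta_M : forall g h : H, Delta (g * h) = tmap2 *%R *%R (Delta g) (Delta h);
  counit_linear : forall (c : k) (g h : H),
    counit (c *: g + h) = c * counit g + counit h;
  counit_1 : counit 1 = 1;
  counit_M : forall g h : H, counit (g * h) = counit g * counit h;
  Delta_coassoc : forall h : H,
    tassoc (tmap Delta idfun (Delta h)) = tmap idfun Delta (Delta h);
  Delta_counitl : forall h : H,
    tlift (fun h1 h2 => counit h1 *: h2) (Delta h) = h;
  Delta_counitr : forall h : H,
    tlift (fun h1 h2 => counit h2 *: h1) (Delta h) = h;
  antipode_linear : forall (c : k) (g h : H),
    antipode (c *: g + h) = c *: antipode g + antipode h;
  antipodel : forall h : H,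
    tlift (fun h1 h2 => antipode h1 * h2) (Delta h) = counit h *: 1;
  antipoder : forall h : H,
    tlift (fun h1 h2 => h1 * antipode h2) (Delta h) = counit h *: 1 }.

#[short(type="hopfType")]
HB.structure Definition Hopf (k : comPzRingType) :=
  {H of isHopf k H & GRing.Algebra k H}.

Definition projective_module (k : pzRingType) (P : lmodType k) : Prop :=
  forall (U V : lmodType k) (p : {linear U -> V}) (f : {linear P -> V}),
    (forall v, exists u, p u = v) ->
    exists f' : {linear P -> U}, forall x, p (f' x) = f x.

HB.mixin Record isComodule (k : comPzRingType) (H : hopfType k) M
    of GRing.Lmodule k M := {
  rho : M -> ktens M H;
  rho_linear : forall (c : k) (m n : M), rho (c *: m + n) = c *: rho m + rho n;
  rho_coassoc : forall m : M,
    tassoc (tmap rho idfun (rho m)) = tmap idfun (@Delta k H) (rho m);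
  rho_counit : forall m : M,
    tlift (fun m0 m1 => counit m1 *: m0) (rho m) = m }.

#[short(type="comodType")]
HB.structure Definition Comodule (k : comPzRingType) (H : hopfType k) :=
  {M of isComodule k H M & GRing.Lmodule k M}.

HB.mixin Record isComoduleAlgebra (k : comPzRingType) (H : hopfType k) A
    of GRing.Algebra k A & Comodule k H A := {
  rho_1 : rho (1 : A) = 1 ⊗ 1;
  rho_M : forall a b : A, rho (a * b) = tmap2 *%R *%R (rho a) (rho b) }.

#[short(type="comodAlgType")]
HB.structure Definition ComoduleAlgebra (k : comPzRingType) (H : hopfType k) :=
  {A of isComoduleAlgebra k H A & GRing.Algebra k A & Comodule k H A}.

(* The objects of _A M_B^H.                                                   *)
HB.mixin Record isHBimodule (k : comPzRingType) (H : hopfType k)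
    (A B : comodAlgType H) M of Comodule k H M := {
  lact : A -> M -> M;
  ract : M -> B -> M;
  lact_linearl : forall (c : k) (a a' : A) (m : M),
    lact (c *: a + a') m = c *: lact a m + lact a' m;
  lact_linearr : forall (c : k) (a : A) (m m' : M),
    lact a (c *: m + m') = c *: lact a m + lact a m';
  lact1 : forall m : M, lact 1 m = m;
  lactA : forall (a a' : A) (m : M), lact a (lact a' m) = lact (a * a') m;
  ract_linearl : forall (c : k) (m m' : M) (b : B),
    ract (c *: m + m') b = c *: ract m b + ract m' b;
  ract_linearr : forall (c : k) (m : M) (b b' : B),
    ract m (c *: b + b') = c *: ract m b + ract m b';
  ract1 : forall m : M, ract m 1 = m;
  ractA : forall (m : M) (b b' : B), ract (ract m b) b' = ract m (b * b');
  lractA : forall (a : A) (m : M) (b : B),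
    ract (lact a m) b = lact a (ract m b);
  rho_lact : forall (a : A) (m : M),
    rho (lact a m) = tmap2 lact *%R (rho a) (rho m);
  rho_ract : forall (m : M) (b : B),
    rho (ract m b) = tmap2 ract *%R (rho m) (rho b) }.

#[short(type="hbimodType")]
HB.structure Definition HBimodule (k : comPzRingType) (H : hopfType k)
  (A B : comodAlgType H) := {M of isHBimodule k H A B M & Comodule k H M}.

(* Coinvariants.                                                              *)

Section Coinvariants.
Variables (k : comPzRingType) (H : hopfType k).

Definition is_coinv (M : comodType H) : {pred M} :=
  fun m => `[< rho m = m ⊗ (1 : H) >].
Arguments is_coinv : clear implicits.

Lemma coinvP (M : comodType H) (m : M) :
  reflect (rho m = m ⊗ (1 : H)) (m \in is_coinv M).
Proof. exact: asboolP. Qed.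

Lemma rhoD (M : comodType H) (m n : M) : rho (m + n) = rho m + rho n.
Proof. by rewrite -[m]scale1r rho_linear !scale1r. Qed.

Lemma rho0 (M : comodType H) : rho (0 : M) = 0.
Proof. by apply: (addrI (rho (0 : M))); rewrite -rhoD !addr0. Qed.

Lemma rhoN (M : comodType H) (m : M) : rho (- m) = - rho m.
Proof. by apply: (addrI (rho m)); rewrite -rhoD !subrr rho0. Qed.

Lemma kpairNl (M N : lmodType k) (m : M) (n : N) : (- m) ⊗ n = - (m ⊗ n).
Proof.
apply: (addrI (m ⊗ n)); rewrite -[LHS]tpairDl !subrr.
by apply: (addrI (0 ⊗ n)); rewrite -[LHS]tpairDl !addr0.
Qed.

Lemma tmap2_kpair (X1 X2 X Y1 Y2 Y : lmodType k) (f : X1 -> X2 -> X)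
    (g : Y1 -> Y2 -> Y) x1 y1 x2 y2 :
  (forall c u u' v, f (c *: u + u') v = c *: f u v + f u' v) ->
  (forall c u v v', f u (c *: v + v') = c *: f u v + f u v') ->
  (forall c u u' v, g (c *: u + u') v = c *: g u v + g u' v) ->
  (forall c u v v', g u (c *: v + v') = c *: g u v + g u v') ->
  tmap2 f g (x1 ⊗ y1) (x2 ⊗ y2) = f x1 x2 ⊗ g y1 y2.
Proof.
move=> fl fr gl gr.
have fDl u u' v : f (u + u') v = f u v + f u' v.
  by rewrite -[u]scale1r fl !scale1r.
have fDr u v v' : f u (v + v') = f u v + f u v'.
  by rewrite -[v]scale1r fr !scale1r.
have gDl u u' v : g (u + u') v = g u v + g u' v.
  by rewrite -[u]scale1r gl !scale1r.
have gDr u v v' : g u (v + v') = g u v + g u v'.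
  by rewrite -[v]scale1r gr !scale1r.
have f0l v : f 0 v = 0 by apply: (addrI (f 0 v)); rewrite -fDl !addr0.
have f0r v : f v 0 = 0 by apply: (addrI (f v 0)); rewrite -fDr !addr0.
have g0l v : g 0 v = 0 by apply: (addrI (g 0 v)); rewrite -gDl !addr0.
have g0r v : g v 0 = 0 by apply: (addrI (g v 0)); rewrite -gDr !addr0.
have fZl c u v : f (c *: u) v = c *: f u v.
  by rewrite -[c *: u]addr0 fl f0l addr0.
have fZr c u v : f u (c *: v) = c *: f u v.
  by rewrite -[c *: v]addr0 fr f0r addr0.
have gZl c u v : g (c *: u) v = c *: g u v.
  by rewrite -[c *: u]addr0 gl g0l addr0.
have gZr c u v : g u (c *: v) = c *: g u v.
  by rewrite -[c *: v]addr0 gr g0r addr0.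
have inner a b : balanced (fun (c : k) (x : X2) => c *: x)
    (fun (c : k) (y : Y2) => c *: y) (fun x2 y2 => f a x2 ⊗ g b y2).
  split=> [x x' y|x y y'|c x y]; rewrite ?fDr ?gDr ?fZr ?gZr;
    [exact: tpairDl|exact: tpairDr|exact: tpair_bal].
have innerE a b : tlift (fun x2 y2 => f a x2 ⊗ g b y2) (x2 ⊗ y2)
    = f a x2 ⊗ g b y2 by exact: (tlift_tpair (inner a b)).
have -> : tmap2 f g (x1 ⊗ y1) (x2 ⊗ y2)
    = tlift (fun a b => f a x2 ⊗ g b y2) (x1 ⊗ y1).
  by congr (tlift _ _); apply/funext => a; apply/funext => b; apply: innerE.
apply: tlift_tpair; split=> [x x' y|x y y'|c x y];
  rewrite ?fDl ?gDl ?fZl ?gZl;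
  [exact: tpairDl|exact: tpairDr|exact: tpair_bal].
Qed.

Lemma is_coinv_zmod_closed (M : comodType H) : zmod_closed (is_coinv M).
Proof.
split; first by apply/coinvP; rewrite rho0; apply: (addrI (0 ⊗ 1));
  rewrite -[RHS]tpairDl !addr0.
move=> m n /coinvP hm /coinvP hn; apply/coinvP.
by rewrite rhoD rhoN hm hn -kpairNl -[LHS]tpairDl.
Qed.

HB.instance Definition _ (M : comodType H) :=
  GRing.isZmodClosed.Build M (is_coinv M) (is_coinv_zmod_closed M).

Definition coinv (M : comodType H) : Type := {m : M | m \in is_coinv M}.
HB.instance Definition _ (M : comodType H) := SubChoice.on (coinv M).
HB.instance Definition _ (M : comodType H) :=
  [SubChoice_isSubZmodule of coinv M by <:].

Lemma mulr_linl (A : algType k) (c : k) (a a' b : A) :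
  (c *: a + a') * b = c *: (a * b) + a' * b.
Proof. by rewrite mulrDl scalerAl. Qed.

Lemma mulr_linr (A : algType k) (c : k) (b a a' : A) :
  b * (c *: a + a') = c *: (b * a) + b * a'.
Proof. by rewrite mulrDr scalerAr. Qed.

Lemma is_coinv_subring_closed (A : comodAlgType H) : subring_closed (is_coinv A).
Proof.
have [_ hB] := is_coinv_zmod_closed A.
split=> //; first by apply/coinvP; apply: rho_1.
move=> a b /coinvP ha /coinvP hb; apply/coinvP.
rewrite rho_M ha hb tmap2_kpair ?mulr1 //;
  by move=> *; rewrite ?mulr_linl ?mulr_linr.
Qed.

HB.instance Definition _ (A : comodAlgType H) :=
  GRing.isSubringClosed.Build A (is_coinv A) (is_coinv_subring_closed A).
Definition coinv_ring (A : comodAlgType H) : Type := coinv A.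
HB.instance Definition _ (A : comodAlgType H) :=
  GRing.SubZmodule.on (coinv_ring A).
HB.instance Definition _ (A : comodAlgType H) :=
  [SubZmodule_isSubNzRing of coinv_ring A by <:].


Section CoinvModule.
Variables (A B : comodAlgType H) (M : hbimodType A B).

Lemma coinv_lact_subproof (a : coinv_ring A) (m : coinv M) :
  lact (val a) (val m) \in is_coinv M.
Proof.
have /coinvP ha := valP a; have /coinvP hm := valP m; apply/coinvP.
rewrite rho_lact ha hm tmap2_kpair ?mulr1 //; move=> *;
  by rewrite ?mulr_linl ?mulr_linr ?lact_linearl ?lact_linearr.
Qed.

Definition coinv_lact (a : coinv_ring A) (m : coinv M) : coinv M :=
  Sub (lact (val a) (val m)) (coinv_lact_subproof a m).

Lemma val_coinv_lact a m : val (coinv_lact a m) = lact (val a) (val m).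
Proof. exact: SubK. Qed.

Lemma coinv_lactA a b m : coinv_lact a (coinv_lact b m) = coinv_lact (a * b) m.
Proof. by apply: val_inj; rewrite !val_coinv_lact lactA. Qed.

Lemma coinv_lact1 : left_id 1 coinv_lact.
Proof. by move=> m; apply: val_inj; rewrite val_coinv_lact lact1. Qed.

Lemma coinv_lactDr : right_distributive coinv_lact +%R.
Proof.
move=> a m n; apply: val_inj; rewrite /= -[X in lact _ (X + _)]scale1r.
by rewrite lact_linearr scale1r.
Qed.

Lemma coinv_lactDl m : {morph coinv_lact^~ m : a b / a + b}.
Proof.
move=> a b; apply: val_inj; rewrite /= -[X in lact (X + _) _]scale1r.
by rewrite lact_linearl scale1r.
Qed.

HB.instance Definition _ := GRing.Zmodule_isLmodule.Build (coinv_ring A) (coinv M)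
  coinv_lactA coinv_lact1 coinv_lactDr coinv_lactDl.

End CoinvModule.

End Coinvariants.
Arguments is_coinv {k H} M.
Arguments coinv {k H} M.
Arguments coinv_ring {k H} A.

(* Tensor products M (x)_B N of bimodules, as objects of _A M_C^H.            *)

Section BimoduleTensor.
Variables (k : comPzRingType) (H : hopfType k) (A B C : comodAlgType H).
Variables (M : hbimodType A B) (N : hbimodType B C).

Definition btens : Type :=
  tens (fun (b : B) (m : M) => ract m b) (fun (b : B) (n : N) => lact b n).
HB.instance Definition _ := GRing.Zmodule.on btens.

Definition bpair (m : M) (n : N) : btens := tpair _ _ m n.

Definition bscale (c : k) (t : btens) : btens :=
  tlift (fun m n => bpair (c *: m) n) t.

Lemma bscale_bal c : balanced (fun (b : B) (m : M) => ract m b)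
  (fun (b : B) (n : N) => lact b n) (fun m n => bpair (c *: m) n).
Proof.
have ract0 (b : B) : ract (0 : M) b = 0.
  apply: (addrI (ract (0 : M) b)); rewrite -{1}[ract 0 b]scale1r.
  by rewrite -ract_linearl scaler0 !addr0.
split=> [m m' n|m n n'|b m n].
- by rewrite scalerDr; apply: tpairDl.
- exact: tpairDr.
- rewrite -[c *: ract m b]addr0 -(ract0 b) -ract_linearl addr0.
  exact: tpair_bal.
Qed.

Lemma bscaleE c m n : bscale c (bpair m n) = bpair (c *: m) n.
Proof. exact: (tlift_tpair (bscale_bal c)). Qed.

Lemma bscaleDr : right_distributive bscale +%R.
Proof. by move=> c s t; apply: (tliftD (bscale_bal c)). Qed.

Lemma bscale_0 c : bscale c 0 = 0.
Proof. exact: (tlift0 (bscale_bal c)). Qed.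

Lemma bscaleA c d t : bscale c (bscale d t) = bscale (c * d) t.
Proof.
elim/(@tens_ind B M N): t => [|m n|s t hs ht]; first by rewrite !bscale_0.
  by rewrite !bscaleE scalerA.
by rewrite !bscaleDr hs ht.
Qed.

Lemma bscale1 : left_id 1 bscale.
Proof.
elim/(@tens_ind B M N) => [|m n|s t hs ht]; first by rewrite !bscale_0.
  by rewrite bscaleE scale1r.
by rewrite bscaleDr hs ht.
Qed.

Lemma bscaleDl t : {morph bscale^~ t : c d / c + d}.
Proof.
move=> c d /=; elim/(@tens_ind B M N): t => [|m n|s t hs ht].
- by rewrite !bscale_0 addr0.
- by rewrite !bscaleE scalerDl; apply: tpairDl.
- by rewrite !bscaleDr hs ht addrACA.
Qed.

HB.instance Definition _ := GRing.Zmodule_isLmodule.Build k btens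
  bscaleA bscale1 bscaleDr bscaleDl.

Definition btens_lact (a : A) (t : btens) : btens :=
  tlift (fun m n => bpair (lact a m) n) t.

Definition btens_ract (t : btens) (c : C) : btens :=
  tlift (fun m n => bpair m (ract n c)) t.

Definition btens_rho (t : btens) : ktens btens H :=
  tlift (fun m n => tmap2 bpair *%R (rho m) (rho n)) t.

End BimoduleTensor.

Section MoritaContext.
Variables (k : comPzRingType) (H : hopfType k) (A B : comodAlgType H).

(* alpha : M (x)_B N -> A is an isomorphism in _A M_A^H.                      *)
Record is_hbimod_iso (M : hbimodType A B) (N : hbimodType B A)
    (alpha : btens M N -> A) : Prop := {
  hiso_linear : forall (c : k) s t, alpha (c *: s + t) = c *: alpha s + alpha t;
  hiso_lact : forall a t, alpha (btens_lact a t) = a * alpha t;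
  hiso_ract : forall t a, alpha (btens_ract t a) = alpha t * a;
  hiso_rho : forall t, rho (alpha t) = tmap alpha idfun (btens_rho t);
  hiso_bij : bijective alpha }.

End MoritaContext.

Record is_strict_HMorita (k : comPzRingType) (H : hopfType k)
    (A B : comodAlgType H) (M : hbimodType A B) (N : hbimodType B A)
    (alpha : btens M N -> A) (beta : btens N M -> B) : Prop := {
  morita_alpha : is_hbimod_iso alpha;
  morita_beta : is_hbimod_iso beta;
  morita_assocM : forall (m : M) (n : N) (m' : M),
    lact (alpha (bpair m n)) m' = ract m (beta (bpair n m'));
  morita_assocN : forall (n : N) (m : M) (n' : N),
    lact (beta (bpair n m)) n' = ract n (alpha (bpair m n')) }.

Definition exact_at (U V W : zmodType) (f : U -> V) (g : V -> W) : Prop :=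
  forall v, g v = 0 <-> exists u, f u = v.

Section FaithfullyFlat.
(* A right R-module P is given here by its action pr r p = p . r.             *)
Variables (R : pzRingType) (P : zmodType) (pr : R -> P -> P).

Definition tens_mod (N : lmodType R) : zmodType :=
  tens pr (fun (r : R) (n : N) => r *: n).

Definition tens_map (N N' : lmodType R) (f : N -> N') (t : tens_mod N) :
    tens_mod N' :=
  tlift (fun p n => tpair _ _ p (f n)) t.

Definition faithfully_flat : Prop :=
  forall (N' N N'' : lmodType R) (f : {linear N' -> N}) (g : {linear N -> N''}),
    exact_at f g <-> exact_at (tens_map f) (tens_map g).

End FaithfullyFlat.

Section Galois.
Variables (k : comPzRingType) (H : hopfType k) (A : comodAlgType H).

Definition coinv_rmul (b : coinv_ring A) (a : A) : A := a * val b.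
Definition coinv_lmul (b : coinv_ring A) (a : A) : A := val b * a.

(* A (x)_{A^coH} A                                                            *)
Definition Atens : zmodType := tens coinv_rmul coinv_lmul.

Definition can' (t : Atens) : ktens A H :=
  tlift (fun a b => tlift (fun a0 a1 => (a0 * b) ⊗ a1) (rho a)) t.

Definition can (t : Atens) : ktens A H :=
  tlift (fun a b => tlift (fun b0 b1 => (a * b0) ⊗ b1) (rho b)) t.

Record right_ff_Galois : Prop := {
  Galois_ff : faithfully_flat coinv_rmul;
  Galois_can' : bijective can' }.

(* can^-1 (1 (x) h), meaningful when can is bijective.                        *)
Definition transl (h : H) : Atens := xget 0 [set t | can t = (1 : A) ⊗ h]%classic.

Section Hom.
(* Right A-modules X and Y, given by their actions.                           *)
Variables (X Y : zmodType) (actX : X -> A -> X) (actY : Y -> A -> Y).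

Definition coinv_hom (f : X -> Y) : Prop :=
  (forall x x', f (x + x') = f x + f x') /\
  (forall (b : coinv_ring A) x, f (actX x (val b)) = actY (f x) (val b)).

Definition MU (f : X -> Y) (h : H) : X -> Y :=
  fun x => tlift (fun l r => actY (f (actX x l)) r) (transl h).

End Hom.

End Galois.

Definition rmul (R : pzRingType) (X : lmodType R^c) (x : X) (r : R) : X :=
  (r : R^c) *: x.

Section Induction.
Variables (k : comPzRingType) (H : hopfType k) (A B : comodAlgType H).
Variable M : hbimodType A B.

Section Object.
Variable X : lmodType A^c.

(* X (x)_A M                                                                  *)
Definition indA : zmodType :=
  tens (fun (a : A) (x : X) => rmul x a) (fun (a : A) (m : M) => lact a m).

Definition indA_ract (t : indA) (b : B) : indA :=
  tlift (fun x m => tpair _ _ x (ract m b)) t.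

(* X (x)_{A^coH} M^coH                                                        *)
Definition indco : zmodType :=
  tens (fun (a : coinv_ring A) (x : X) => rmul x (val a))
       (fun (a : coinv_ring A) (m : coinv M) => a *: m).

Definition indco_to_indA (t : indco) : indA :=
  tlift (fun x m => tpair _ _ x (val m)) t.

(* The right B-action transported along [indco_to_indA], which is bijective   *)
(* when A is a right faithfully flat H-Galois extension.                      *)
Definition indco_ract (t : indco) (b : B) : indco :=
  xget 0 [set s | indco_to_indA s = indA_ract (indco_to_indA t) b]%classic.

End Object.

(* f (x)_{A^coH} M^coH                                                        *)
Definition indco_map (X Y : lmodType A^c) (f : X -> Y) (t : indco X) : indco Y :=
  tlift (fun x m => tpair _ _ (f x) m) t.

End Induction.

Arguments indco {k H A B} M X.
Arguments indco_map {k H A B} M {X Y} f t.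

(* Main.v *)
Require Import Defs.
From HB Require Import structures.
From mathcomp Require Import all_boot all_algebra.
From mathcomp Require Import boolp classical_sets.

Set Implicit Arguments.
Unset Strict Implicit.
Unset Printing Implicit Defensive.
Import GRing.Theory.
Local Open Scope ring_scope.

(** Write A0, B0, M0 for the coinvariants of A, B, M, and [l(h) ⊗ r(h)] for
    [transl A h], the element of [A ⊗_{A0} A] that [can] sends to [1 ⊗ h].

    The right B-action on [X ⊗_{A0} M0] is controlled by the case X = A: if
    [m b = \sum_i a_i m_i] in M with the [m_i] coinvariant, then
    [(x ⊗ m) b = \sum_i x a_i ⊗ m_i].  Evaluating both sides of the claim at
    [x ⊗ m] and pushing the result to [Y ⊗_A M], they become the images, under
    the additive map [a ⊗ n |-> f (x a) ⊗ n] from [A ⊗_{A0} M] ([map_act]), of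

      [\sum_i a_i ⊗ m_i r_B(h)]  with  [\sum_i a_i m_i = m l_B(h)],
      and  [l_A(h) ⊗ r_A(h) m].

    So it suffices that these two elements of [A ⊗_{A0} M] agree
    ([transl_exchange]).  For every left A-module V the map
    [gal' : A ⊗_{A0} V -> V ⊗ H], [a ⊗ v |-> a_0 v ⊗ a_1], is bijective as soon
    as [can'] is ([gal'_bij]), and it sends both elements to [m ⊗ S(h)]: the
    second one because [can' (l(h) ⊗ r(h)) = 1 ⊗ S(h)] ([can'_transl]), the first
    one because [m b] has coaction [m b_0 ⊗ b_1], which reduces it to the same
    formula for B.

    Making sense of the B-action needs the structure theorem
    [A ⊗_{A0} M0 = M] ([coinv_mul_bij]), from which
    [X ⊗_{A0} M0 = X ⊗_A M] follows for every X.  It comes from tensoring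
    [0 -> M0 -> M -> M ⊗ H], the last map being [rho - (- ⊗ 1)], with A over A0,
    which preserves exactness by flatness.  The terms [A ⊗_{A0} M] and
    [A ⊗_{A0} (M ⊗ H)] are then identified by means of [gal'] and of
    [gal : a ⊗ v |-> a v_0 ⊗ v_1].

    The two maps are related by [twist : v ⊗ h |-> v_0 ⊗ v_1 S(h)]
    ([twist_gal]): [twist (gal t) = gal' t] for every Hopf module V, and [twist]
    is injective because S is bijective.  This also compares [can] with
    [can'], which are [gal] and [gal'] for V = A. *)

(** * Additive maps and balanced tensor products *)

Section AdditiveMaps.
Variables U V : zmodType.

Lemma additive0 (F : U -> V) : {morph F : x y / x + y} -> F 0 = 0.
Proof. by move=> FD; apply: (addrI (F 0)); rewrite -FD !addr0. Qed.

Lemma additiveN (F : U -> V) : {morph F : x y / x + y} -> {morph F : x / - x}.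
Proof.
by move=> FD x; apply: (addrI (F x)); rewrite -FD !subrr additive0.
Qed.

Lemma additive_inj (F : U -> V) : {morph F : x y / x + y} ->
  (forall u, F u = 0 -> u = 0) -> injective F.
Proof.
move=> FD F0 u v uv; apply/eqP; rewrite -subr_eq0; apply/eqP/F0.
by rewrite FD additiveN // uv subrr.
Qed.

End AdditiveMaps.

Section Tens.
Variables (I : Type) (X Y : zmodType) (ra : I -> X -> X) (la : I -> Y -> Y).
Local Notation T := (tens ra la).

Lemma tens_ext (Z : zmodType) (F G : T -> Z) :
    {morph F : s t / s + t} -> {morph G : s t / s + t} ->
  (forall x y, F (tpair ra la x y) = G (tpair ra la x y)) -> F =1 G.
Proof.
move=> FD GD FG; elim/tens_ind => [|//|s t hs ht].
  by rewrite !additive0.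
by rewrite FD GD hs ht.
Qed.

Lemma eq_tlift (Z : zmodType) (g g' : X -> Y -> Z) (t : T) :
  (forall x y, g x y = g' x y) -> tlift g t = tlift g' t.
Proof. by move=> gg'; apply: eq_bigr => p _. Qed.

(** For arbitrary [g], since [tlift g t] is literally a sum over a chosen
    expression of [t], and [F] commutes with sums. *)
Lemma tlift_comp (Z Z' : zmodType) (F : Z -> Z') (g : X -> Y -> Z) (t : T) :
    {morph F : x y / x + y} ->
  F (tlift g t) = tlift (fun x y => F (g x y)) t.
Proof. by move=> FD; apply: big_morph => //; apply: additive0. Qed.

Lemma tlift_add (Z : zmodType) (g g' : X -> Y -> Z) (t : T) :
  tlift (fun x y => g x y + g' x y) t = tlift g t + tlift g' t.
Proof. exact: big_split. Qed.

Lemma tlift_id (t : T) : tlift (tpair ra la) t = t.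
Proof. by rewrite -[RHS]tsum_repr tsumE. Qed.

End Tens.

Lemma tlift_exchange (I I' : Type) (X Y X' Y' Z : zmodType)
    (ra : I -> X -> X) la (ra' : I' -> X' -> X') la'
    (g : X -> Y -> X' -> Y' -> Z)
    (t : @tens I X Y ra la) (s : @tens I' X' Y' ra' la') :
  tlift (fun x y => tlift (g x y) s) t =
  tlift (fun x' y' => tlift (fun x y => g x y x' y') t) s.
Proof. exact: exchange_big. Qed.

(** * Multilinear calculus over the base ring *)

Section Linear.
Variable k : comPzRingType.
Implicit Types X Y Z : lmodType k.

Lemma linear_additive X Y (f : X -> Y) : linear f -> {morph f : x y / x + y}.
Proof. by move=> fl x y; rewrite -[x]scale1r fl !scale1r. Qed.

Lemma linear_scale X Y (f : X -> Y) c x : linear f -> f (c *: x) = c *: f x.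
Proof.
move=> fl; have f0 := additive0 (linear_additive fl).
by rewrite -[c *: x]addr0 fl f0 addr0.
Qed.

Definition bilinear2 X Y Z (g : X -> Y -> Z) :=
  (forall y, linear (g^~ y)) /\ (forall x, linear (g x)).

Lemma bilinear_balanced X Y Z (g : X -> Y -> Z) : bilinear2 g ->
  balanced (fun (c : k) (x : X) => c *: x) (fun (c : k) (y : Y) => c *: y) g.
Proof.
move=> [gl gr]; split=> [x x' y|x y y'|c x y].
- exact: (linear_additive (gl y)).
- exact: (linear_additive (gr x)).
- by rewrite (linear_scale c x (gl y)) (linear_scale c y (gr x)).
Qed.

Lemma linear_sub X Y (f g : X -> Y) : linear f -> linear g ->
  linear (fun x => f x - g x).
Proof. by move=> fl gl c x y; rewrite fl gl opprD addrACA scalerBr. Qed.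

Lemma linear_comp X Y Z (g : Y -> Z) (f : X -> Y) :
  linear g -> linear f -> linear (fun x => g (f x)).
Proof. by move=> gl fl c x y; rewrite fl gl. Qed.

Lemma kscale_pair X Y c (x : X) (y : Y) : c *: (x ⊗ y) = (c *: x) ⊗ y.
Proof. exact: kscaleE. Qed.

Lemma kpair_scale X Y c (x : X) (y : Y) : (c *: x) ⊗ y = x ⊗ (c *: y).
Proof. exact: tpair_bal. Qed.

Lemma kpair_linearl X Y (y : Y) : linear (fun x : X => x ⊗ y).
Proof. by move=> c x x'; rewrite kscale_pair; apply: tpairDl. Qed.

Lemma kpair_linearr X Y (x : X) : linear (fun y : Y => x ⊗ y).
Proof. by move=> c y y'; rewrite kscale_pair kpair_scale; apply: tpairDr. Qed.

(** [tlift] at k-modules, with values in a k-module: fixing these structures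
    makes all nested lifts syntactically uniform, so that they can be rewritten.
    In Sweedler notation [klift g (Delta h)] is the sum of the [g h_1 h_2]. *)
Definition klift X Y Z (g : X -> Y -> Z) (t : ktens X Y) : Z := tlift g t.

Lemma eq_klift X Y Z (g g' : X -> Y -> Z) (t : ktens X Y) :
  (forall x y, g x y = g' x y) -> klift g t = klift g' t.
Proof. exact: eq_tlift. Qed.

Lemma klift_comp X Y Z Z' (F : Z -> Z') (g : X -> Y -> Z) (t : ktens X Y) :
  linear F -> F (klift g t) = klift (fun x y => F (g x y)) t.
Proof. by move=> Fl; apply: (tlift_comp g t (linear_additive Fl)). Qed.

Lemma klift_sub X Y Z (g g' : X -> Y -> Z) (t : ktens X Y) :
  klift (fun x y => g x y - g' x y) t = klift g t - klift g' t.
Proof. exact: sumrB. Qed.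

Lemma klift_exchange X Y X' Y' Z (g : X -> Y -> X' -> Y' -> Z)
    (t : ktens X Y) (s : ktens X' Y') :
  klift (fun x y => klift (g x y) s) t =
  klift (fun x' y' => klift (fun x y => g x y x' y') t) s.
Proof. exact: tlift_exchange. Qed.

Lemma klift_id X Y (t : ktens X Y) : klift (fun x y => x ⊗ y) t = t.
Proof. exact: tlift_id. Qed.

Lemma klift_linear_param X' X Y Z (g : X' -> X -> Y -> Z) (t : ktens X Y) :
  (forall x y, linear (fun x' => g x' x y)) -> linear (fun x' => klift (g x') t).
Proof.
move=> gl c x y; rewrite /klift /tlift scaler_sumr -big_split.
by apply: eq_bigr => p _; apply: gl.
Qed.

Lemma ktens_ind X Y (P : ktens X Y -> Prop) :
    P 0 -> (forall x y, P (x ⊗ y)) -> (forall s t, P s -> P t -> P (s + t)) ->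
  forall t, P t.
Proof. exact: tens_ind. Qed.

Lemma ktens_ext X Y Z (F G : ktens X Y -> Z) : linear F -> linear G ->
  (forall x y, F (x ⊗ y) = G (x ⊗ y)) -> F =1 G.
Proof.
by move=> Fl Gl; apply: tens_ext; [exact: linear_additive Fl|exact: linear_additive Gl].
Qed.

Section Lift.
Variables (X Y Z : lmodType k) (g : X -> Y -> Z).
Hypothesis gb : bilinear2 g.

Lemma klift_kpair x y : klift g (x ⊗ y) = g x y.
Proof. exact: (tlift_tpair (bilinear_balanced gb)). Qed.

Lemma klift_linear : linear (fun t : ktens X Y => klift g t).
Proof.
have gD : {morph klift g : s t / s + t} := tliftD (bilinear_balanced gb).
move=> c s t; rewrite gD; congr (_ + _).
elim/ktens_ind: s => [|x y|s s' hs hs'].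
- by rewrite scaler0 (additive0 gD) scaler0.
- by rewrite kscale_pair !klift_kpair (linear_scale c x (gb.1 y)).
- by rewrite scalerDr !gD hs hs' scalerDr.
Qed.

Lemma klift_klift X' Y' (h : X' -> Y' -> ktens X Y) (t : ktens X' Y') :
  klift g (klift h t) = klift (fun x y => klift g (h x y)) t.
Proof. exact: (klift_comp h t klift_linear). Qed.

End Lift.

Section Algebra.
Variable A : algType k.
Lemma mul_linearl (b : A) : linear (fun a : A => a * b).
Proof. by move=> c a a'; rewrite mulr_linl. Qed.
Lemma mul_linearr (a : A) : linear (fun b : A => a * b).
Proof. by move=> c b b'; rewrite mulr_linr. Qed.
End Algebra.

End Linear.

(** * Hopf algebras, comodules and Hopf modules *)

Section Comodules.
Variables (k : comPzRingType) (H : hopfType k).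

Lemma Delta_lin : linear (@Delta k H). Proof. exact: Delta_linear. Qed.
Lemma antipode_lin : linear (@antipode k H). Proof. exact: antipode_linear. Qed.

Lemma counit_scale_linear (X : lmodType k) (v : X) : linear (fun h : H => counit h *: v).
Proof. by move=> c g h; rewrite counit_linear scalerDl scalerA. Qed.

Lemma scale_linear (X : lmodType k) (c : k) : linear (fun v : X => c *: v).
Proof. by move=> d u v; rewrite scalerDr !scalerA mulrC. Qed.

Lemma antipode1 : antipode (1 : H) = 1.
Proof.
have : klift (fun h1 h2 : H => antipode h1 * h2) (Delta 1) = counit (1 : H) *: 1.
  exact: antipodel.
rewrite Delta_1 counit_1 scale1r klift_kpair ?mulr1 //.
split=> [y|x]; last exact: mul_linearr.
exact: (linear_comp (@mul_linearl k H y) antipode_lin).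
Qed.

Definition trilinear (X Y W Z : lmodType k) (g : X -> Y -> W -> Z) : Prop :=
  [/\ forall y w, linear (fun x => g x y w), forall x w, linear (fun y => g x y w)
    & forall x y, linear (g x y)].

End Comodules.

(** Proves linearity of an iterated Sweedler expression in a variable that
    occurs exactly once in it, by peeling off the operation around the
    occurrence; the linearity of abstract operations is taken from the context. *)
Ltac lin := cbv beta; lazymatch goal with
  | |- bilinear2 _ => split=> ?; lin
  | |- trilinear _ => split=> ? ?; lin
  | |- linear (fun x => x) => by []
  | |- linear (kpair _) => exact: kpair_linearr
  | |- linear (GRing.mul _) => exact: mul_linearr
  | |- linear (klift _) => refine (klift_linear _); lin
  | |- linear (fun x => kpair _ _) =>
      first [refine (linear_comp (kpair_linearl _) _)
            |refine (linear_comp (kpair_linearr _) _)]; lin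
  | |- linear (fun x => GRing.mul _ _) =>
      first [refine (linear_comp (mul_linearl _) _)
            |refine (linear_comp (mul_linearr _) _)]; lin
  | |- linear (fun x => GRing.scale _ _) =>
      first [refine (linear_comp (counit_scale_linear _) _)
            |refine (linear_comp (@scale_linear _ _ _) _)]; lin
  | |- linear (fun x => klift _ _) =>
      first [refine (klift_linear_param _ _) => ? ?
            |refine (linear_comp (klift_linear _) _)]; lin
  | |- _ => first
      [ assumption
      | match goal with H : forall v, linear _ |- _ => exact: H end
      | match goal with H : forall v w, linear _ |- _ => exact: H end
      | refine (linear_comp (@antipode_lin _ _) _); lin
      | refine (linear_comp (@Delta_lin _ _) _); lin
      | refine (linear_comp (@rho_linear _ _ _) _); lin
      | match goal with
        | H : forall v, linear _ |- _ => refine (linear_comp (H _) _); lin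
        | H : forall v w, linear _ |- _ => refine (linear_comp (H _ _) _); lin
        | H : linear _ |- _ => refine (linear_comp H _); lin
        end
      | idtac ]
  end.

Section HopfModules.
Variables (k : comPzRingType) (H : hopfType k).

Section Coassociativity.
Variables (M : comodType H).

Lemma tassoc_linear (X Y Z : lmodType k) : linear (@tassoc k X Y Z).
Proof.
apply: (klift_linear (g := fun s z => klift (fun x y => x ⊗ (y ⊗ z)) s)); lin.
Qed.

Lemma tassoc_kpair (X Y Z : lmodType k) (s : ktens X Y) (z : Z) :
  tassoc (s ⊗ z) = klift (fun x y => x ⊗ (y ⊗ z)) s.
Proof.
apply: (klift_kpair (g := fun s z => klift (fun x y => x ⊗ (y ⊗ z)) s)); lin.
Qed.

(** Coassociativity in Sweedler form, [m_00 ⊗ m_01 ⊗ m_1 = m_0 ⊗ m_11 ⊗ m_12],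
    tested against a trilinear [g]: both sides of [rho_coassoc] are fed to the
    map induced by [g]. *)
Lemma rho_coassocE (Z : lmodType k) (g : M -> H -> H -> Z) (m : M) :
  trilinear g ->
  klift (fun m0 m1 => klift (fun x y => g x y m1) (rho m0)) (rho m) =
  klift (fun m0 m1 => klift (g m0) (Delta m1)) (rho m).
Proof.
move=> [g1 g2 g3].
have gm x : bilinear2 (g x) by split.
pose G (m0 : M) (t : ktens H H) := klift (g m0) t.
have Gl : bilinear2 G.
  by split=> [t|x]; [apply: (klift_linear_param (g := g)) => ? ?|exact: klift_linear].
have E : tassoc (klift (fun m0 m1 => rho m0 ⊗ m1) (rho m)) =
         klift (fun m0 m1 => m0 ⊗ Delta m1) (rho m) := rho_coassoc m.
move/(congr1 (klift G)): E.
rewrite (klift_comp _ _ (@tassoc_linear _ _ _)) !klift_klift // => E.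
transitivity (klift (fun x y => klift G (tassoc (rho x ⊗ y))) (rho m)).
  apply: eq_klift => m0 m1; rewrite tassoc_kpair klift_klift //.
  by apply: eq_klift => x y; rewrite klift_kpair // /G klift_kpair.
by rewrite E; apply: eq_klift => m0 m1; rewrite klift_kpair.
Qed.
End Coassociativity.

Variables (A : comodAlgType H).

Record left_module (V : lmodType k) (la : A -> V -> V) : Prop := LeftModule {
  lm_linearl : forall v, linear (fun a => la a v);
  lm_linearr : forall a, linear (la a);
  lm_1 : forall v, la 1 v = v;
  lm_A : forall a b v, la a (la b v) = la (a * b) v }.

(** The objects of [_A M^H], with the coaction as an explicit map so that A
    itself, [M] and [M ⊗ H] are instances on an equal footing. Coassociativity is
    required in the only form in which it is used. *)
Record hopf_module (V : lmodType k) (la : A -> V -> V) (r : V -> ktens V H) : Prop :=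
 HopfModule {
  hm_module :> left_module la;
  hm_rho : linear r;
  hm_coassoc : forall (Z : lmodType k) (g : V -> H -> H -> Z), trilinear g ->
    forall v,
    klift (fun v0 v1 => klift (fun x y => g x y v1) (r v0)) (r v) =
    klift (fun v0 v1 => klift (g v0) (Delta v1)) (r v);
  hm_counit : forall v, klift (fun v0 v1 => counit v1 *: v0) (r v) = v;
  hm_rho_la : forall a v, r (la a v) =
    klift (fun a0 a1 => klift (fun v0 v1 => la a0 v0 ⊗ (a1 * v1)) (r v)) (rho a) }.

Lemma regular_hopf_module : hopf_module (fun a b : A => a * b) rho.
Proof.
split; [split| | | | ].
- exact: mul_linearl.
- exact: mul_linearr.
- exact: mul1r.
- exact: mulrA.
- exact: rho_linear.
- by move=> Z g gl v; apply: rho_coassocE.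
- exact: rho_counit.
- exact: rho_M.
Qed.

Lemma hbimod_hopf_module (B : comodAlgType H) (M : hbimodType A B) :
  hopf_module (@lact k H A B M) rho.
Proof.
split; [split| | | | ].
- by move=> m c a a'; apply: lact_linearl.
- by move=> a c m m'; apply: lact_linearr.
- exact: lact1.
- exact: lactA.
- exact: rho_linear.
- by move=> Z g gl v; apply: rho_coassocE.
- exact: rho_counit.
- exact: rho_lact.
Qed.

(** [V ⊗ H] with A acting and coacting through V only; the coaction of V puts
    its H-component last: [v ⊗ h |-> (v_0 ⊗ h) ⊗ v_1]. *)
Section TensorH.
Variables (V : lmodType k) (la : A -> V -> V).

Definition tensH_lact (a : A) (t : ktens V H) : ktens V H :=
  klift (fun v h => la a v ⊗ h) t.

Variable r : V -> ktens V H.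

Definition tensH_rho (t : ktens V H) : ktens (ktens V H) H :=
  klift (fun v h => klift (fun v0 v1 => (v0 ⊗ h) ⊗ v1) (r v)) t.

Lemma tensH_module : left_module la -> left_module tensH_lact.
Proof.
case=> lal lar la1 laA; rewrite /tensH_lact; split.
- by move=> v; lin.
- by move=> a; lin.
- move=> t; rewrite -[RHS]klift_id; apply: eq_klift => v h.
  by rewrite la1.
- move=> a b t; rewrite klift_klift; last by lin.
  by apply: eq_klift => v h; rewrite klift_kpair ?laA //; lin.
Qed.

Lemma tensH_hopf_module : hopf_module la r -> hopf_module tensH_lact tensH_rho.
Proof.
case=> hm rl coas coun rla; have [lal lar la1 laA] := hm.
have [tlal tlar tla1 tlaA] := tensH_module hm.
have rhol : linear tensH_rho by rewrite /tensH_rho; lin.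
have rhoE v h : tensH_rho (v ⊗ h) = klift (fun v0 v1 => (v0 ⊗ h) ⊗ v1) (r v).
  by rewrite /tensH_rho klift_kpair //; lin.
split=> //.
- move=> Z g [g1 g2 g3].
  apply: ktens_ext; [by lin|by lin|move=> v h].
  rewrite rhoE klift_klift; last by lin.
  rewrite klift_klift; last by lin.
  transitivity (klift (fun v0 v1 => klift (fun x y => g (x ⊗ h) y v1) (r v0)) (r v)).
    apply: eq_klift => v0 v1; rewrite klift_kpair; last by lin.
    rewrite rhoE klift_klift; last by lin.
    by apply: eq_klift => x y; rewrite klift_kpair //; lin.
  rewrite (coas Z (fun x y z => g (x ⊗ h) y z)); last by lin.
  by apply: eq_klift => v0 v1; rewrite klift_kpair //; lin.
- apply: ktens_ext; [by lin|by lin|move=> v h].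
  rewrite rhoE klift_klift; last by lin.
  rewrite -[in RHS](coun v) (klift_comp _ _ (kpair_linearl h)).
  apply: eq_klift => x y; rewrite klift_kpair; last by lin.
  exact: kscale_pair.
- move=> a; apply: ktens_ext; [by lin|by lin|move=> v h].
  rewrite {1}/tensH_lact klift_kpair; last by lin.
  rewrite !rhoE rla klift_klift; last by lin.
  apply: eq_klift => a0 a1; rewrite !klift_klift; try by lin.
  apply: eq_klift => v0 v1; rewrite klift_kpair; last by lin.
  rewrite klift_kpair; last by lin.
  by rewrite /tensH_lact klift_kpair //; lin.
Qed.

End TensorH.
End HopfModules.

(** * The two canonical maps and their comparison *)

Section Canonical.
Variables (k : comPzRingType) (H : hopfType k) (A : comodAlgType H).

Definition coinv_act (V : lmodType k) (la : A -> V -> V) (b : coinv_ring A) (v : V) : V :=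
  la (val b) v.

Section Maps.
Variables (V : lmodType k) (la : A -> V -> V) (r : V -> ktens V H).

Definition Atensor : zmodType := tens (@coinv_rmul k H A) (coinv_act la).
Definition apair (a : A) (v : V) : Atensor := tpair _ _ a v.

Definition gal' (t : Atensor) : ktens V H :=
  tlift (fun a v => klift (fun a0 a1 => la a0 v ⊗ a1) (rho a)) t.

Definition gal (t : Atensor) : ktens V H :=
  tlift (fun a v => klift (fun v0 v1 => la a v0 ⊗ v1) (r v)) t.

Definition twist (t : ktens V H) : ktens V H :=
  klift (fun v h => klift (fun v0 v1 => v0 ⊗ (v1 * antipode h)) (r v)) t.

Lemma Atensor_ind (P : Atensor -> Prop) :
    P 0 -> (forall a v, P (apair a v)) -> (forall s t, P s -> P t -> P (s + t)) ->
  forall t, P t.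
Proof. exact: tens_ind. Qed.

Lemma rho_mul_coinv (a : A) (b : coinv_ring A) :
  rho (a * val b) = klift (fun a0 a1 => (a0 * val b) ⊗ a1) (rho a).
Proof.
have /coinvP hb := valP b.
rewrite (hm_rho_la (regular_hopf_module A)); apply: eq_klift => a0 a1.
by rewrite hb klift_kpair ?mulr1 //; lin.
Qed.

Section GalLeft.
Hypothesis hla : left_module la.

Lemma gal'_balanced : balanced (@coinv_rmul k H A) (coinv_act la)
  (fun a v => klift (fun a0 a1 => la a0 v ⊗ a1) (rho a)).
Proof.
have [lal lar la1 laA] := hla.
split=> [a a' v|a v v'|b a v].
- by apply: (linear_additive
    (f := fun a => klift (fun a0 a1 => la a0 v ⊗ a1) (rho a))); lin.
- by apply: (linear_additive
    (f := fun v => klift (fun a0 a1 => la a0 v ⊗ a1) (rho a))); lin.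
- rewrite /coinv_rmul rho_mul_coinv klift_klift; last by lin.
  apply: eq_klift => a0 a1; rewrite klift_kpair; last by lin.
  by rewrite -laA.
Qed.

Lemma gal'D : {morph gal' : s t / s + t}.
Proof. exact: (tliftD gal'_balanced). Qed.

Lemma gal'_pair a v : gal' (apair a v) = klift (fun a0 a1 => la a0 v ⊗ a1) (rho a).
Proof. exact: (tlift_tpair gal'_balanced). Qed.

End GalLeft.

Section Gal.
Hypothesis hV : hopf_module la r.

Lemma rho_coinv_act (b : coinv_ring A) (v : V) :
  r (coinv_act la b v) = klift (fun v0 v1 => la (val b) v0 ⊗ v1) (r v).
Proof.
have [[lal lar la1 laA] rl _ _ rla] := hV; have /coinvP hb := valP b.
rewrite rla hb klift_kpair; last by lin.
by apply: eq_klift => v0 v1; rewrite mul1r.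
Qed.

Lemma gal_balanced : balanced (@coinv_rmul k H A) (coinv_act la)
  (fun a v => klift (fun v0 v1 => la a v0 ⊗ v1) (r v)).
Proof.
have [[lal lar la1 laA] rl _ _ rla] := hV.
split=> [a a' v|a v v'|b a v].
- by apply: (linear_additive
    (f := fun a => klift (fun v0 v1 => la a v0 ⊗ v1) (r v))); lin.
- by apply: (linear_additive
    (f := fun v => klift (fun v0 v1 => la a v0 ⊗ v1) (r v))); lin.
- rewrite rho_coinv_act klift_klift; last by lin.
  apply: eq_klift => v0 v1; rewrite klift_kpair; last by lin.
  by rewrite laA.
Qed.

Lemma galD : {morph gal : s t / s + t}.
Proof. exact: (tliftD gal_balanced). Qed.

Lemma gal_pair a v : gal (apair a v) = klift (fun v0 v1 => la a v0 ⊗ v1) (r v).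
Proof. exact: (tlift_tpair gal_balanced). Qed.

Lemma twist_linear : linear twist.
Proof. by have [_ rl _ _ _] := hV; rewrite /twist; lin. Qed.

Lemma twist_kpair v h :
  twist (v ⊗ h) = klift (fun v0 v1 => v0 ⊗ (v1 * antipode h)) (r v).
Proof. by have [_ rl _ _ _] := hV; rewrite /twist klift_kpair //; lin. Qed.

Lemma rho_counit_kpair (v : V) (h : H) :
  klift (fun v0 v1 => v0 ⊗ (counit v1 *: h)) (r v) = v ⊗ h.
Proof.
rewrite -[in RHS](hm_counit hV v) (klift_comp _ _ (kpair_linearl h)).
by apply: eq_klift => x y; rewrite kpair_scale.
Qed.

(** On [a ⊗ v] the left side is [a_0 v_0 ⊗ a_1 v_1 S(v_2)], and [v_1 S(v_2)]
    collapses to a counit. *)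
Lemma twist_gal (t : Atensor) : twist (gal t) = gal' t.
Proof.
have [[lal lar la1 laA] rl coas coun rla] := hV.
have hm := hm_module hV; have tl := twist_linear.
elim/Atensor_ind: t => [|a v|s t hs ht]; first 1 last.
- rewrite gal_pair (klift_comp _ _ tl) gal'_pair //.
  transitivity (klift (fun a0 a1 => klift (fun v0 v1 => klift (fun x y =>
      la a0 x ⊗ (a1 * y * antipode v1)) (r v0)) (r v)) (rho a)).
    rewrite [RHS]klift_exchange; apply: eq_klift => v0 v1.
    rewrite twist_kpair rla klift_klift; last by lin.
    apply: eq_klift => a0 a1; rewrite klift_klift; last by lin.
    by apply: eq_klift => x y; rewrite klift_kpair //; lin.
  apply: eq_klift => a0 a1.
  rewrite (coas _ (fun x y z => la a0 x ⊗ (a1 * y * antipode z))); last by lin.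
  rewrite -[in RHS](coun v) (klift_comp _ _ (lar a0)) (klift_comp _ _ (kpair_linearl a1)).
  apply: eq_klift => v0 v1.
  have E : klift (fun y z => y * antipode z) (Delta v1) = counit v1 *: (1 : H).
    exact: antipoder.
  rewrite (linear_scale _ _ (lar a0)) kpair_scale -[in RHS](mulr1 a1).
  rewrite scalerAr -E (klift_comp _ _ (mul_linearr a1)).
  rewrite (klift_comp _ _ (kpair_linearr _)).
  by apply: eq_klift => x y; rewrite mulrA.
- by rewrite galD gal'D // (linear_additive tl) hs ht.
- by rewrite (additive0 galD) (additive0 (gal'D hm)) (additive0 (linear_additive tl)).
Qed.

(** A left inverse is [v ⊗ g |-> v_0 ⊗ S^-1 (S(v_1) g)]: composing with [twist]
    leaves [v_0 ⊗ S^-1 (S(v_1) v_2 S(h)) = v ⊗ h]. *)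
Lemma twist_inj : bijective (antipode : H -> H) -> injective twist.
Proof.
have [[lal lar la1 laA] rl coas coun rla] := hV.
case=> Sinv SK KS.
have Sl : linear Sinv.
  by move=> c x y; rewrite -{1}[x]KS -{1}[y]KS -antipode_linear SK.
pose G t := klift (fun v g => klift (fun v0 v1 => v0 ⊗ Sinv (antipode v1 * g)) (r v)) t.
have Gl : linear G by rewrite /G; lin.
apply: (can_inj (g := G)); apply: ktens_ext.
- exact: linear_comp Gl twist_linear.
- by [].
move=> v h; rewrite twist_kpair (klift_comp _ _ Gl).
transitivity (klift (fun v0 v1 => klift (fun x y =>
    x ⊗ Sinv (antipode y * (v1 * antipode h))) (r v0)) (r v)).
  by apply: eq_klift => v0 v1; rewrite /G klift_kpair //; lin.
rewrite (coas _ (fun x y z => x ⊗ Sinv (antipode y * (z * antipode h)))); last by lin.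
rewrite -rho_counit_kpair; apply: eq_klift => v0 v1.
have E : klift (fun y z => antipode y * z) (Delta v1) = counit v1 *: (1 : H).
  exact: antipodel.
rewrite -[in RHS](SK h) -(linear_scale _ _ Sl) -[in RHS](mul1r (antipode h)).
rewrite scalerAl -E (klift_comp _ _ (mul_linearl _)) (klift_comp _ _ Sl).
rewrite (klift_comp _ _ (kpair_linearr _)).
by apply: eq_klift => x y; rewrite mulrA.
Qed.

Lemma twist_coinv (v : V) : twist (v ⊗ 1) = r v.
Proof.
by rewrite twist_kpair antipode1 -[RHS]klift_id; apply: eq_klift => v0 v1; rewrite mulr1.
Qed.

End Gal.
End Maps.
End Canonical.

(** * Consequences of the Galois condition *)

Section GaloisBijectivity.
Variables (k : comPzRingType) (H : hopfType k) (A : comodAlgType H).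

Section Act.
Variables (V : lmodType k) (la : A -> V -> V).
Hypothesis hla : left_module la.

(** [a ⊗ b |-> a ⊗ b v]; for V = A it is right multiplication by [v] on
    [A ⊗_{A0} A]. *)
Definition contract (v : V) (t : Atens A) : Atensor la :=
  tlift (fun a b => apair la a (la b v)) t.

Lemma apairDl a a' (v : V) : apair la (a + a') v = apair la a v + apair la a' v.
Proof. exact: tpairDl. Qed.

Lemma apairDr a (v v' : V) : apair la a (v + v') = apair la a v + apair la a v'.
Proof. exact: tpairDr. Qed.

Lemma apair_bal a (b : coinv_ring A) (v : V) :
  apair la (a * val b) v = apair la a (la (val b) v).
Proof. exact: tpair_bal. Qed.

Lemma contract_balanced v : balanced (@coinv_rmul k H A) (@coinv_lmul k H A)
  (fun a b => apair la a (la b v)).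
Proof.
have [lal lar la1 laA] := hla.
split=> [a a' b|a b b'|b a a']; first exact: apairDl.
- by rewrite (linear_additive (lal v)) apairDr.
- by rewrite [LHS]apair_bal laA.
Qed.

Lemma contractD v : {morph contract v : s t / s + t}.
Proof. exact: (tliftD (contract_balanced v)). Qed.

Lemma contract_pair v a b : contract v (tpair _ _ a b) = apair la a (la b v).
Proof. exact: (tlift_tpair (contract_balanced v)). Qed.

Lemma contractDl t : {morph contract^~ t : v w / v + w}.
Proof.
move=> v w; rewrite -tlift_add; apply: eq_tlift => a b.
by rewrite (linear_additive (lm_linearr hla b)) apairDr.
Qed.

Lemma gal'_contract v t :
  gal' (contract v t) = klift (fun a h => la a v ⊗ h) (can' t).
Proof.
have [lal lar la1 laA] := hla.
have bl : bilinear2 (fun a (h : H) => la a v ⊗ h) by lin.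
have cD : {morph @can' k H A : s t / s + t}.
  exact: (gal'D (hm_module (regular_hopf_module A))).
have lD := linear_additive (klift_linear bl).
elim/tens_ind: t => [|a b|s t hs ht]; last 1 first.
- by rewrite contractD gal'D // cD [RHS]lD hs ht.
- by rewrite (additive0 (contractD v)) (additive0 (gal'D hla)) (additive0 cD)
    [RHS](additive0 lD).
rewrite contract_pair gal'_pair //.
have -> : can' (tpair _ _ a b) = klift (fun a0 a1 => (a0 * b) ⊗ a1) (rho a).
  exact: (gal'_pair (hm_module (regular_hopf_module A))).
rewrite klift_klift //; apply: eq_klift => a0 a1.
by rewrite klift_kpair ?laA.
Qed.

End Act.

Hypothesis can'_bij : bijective (@can' k H A).

(** [A ⊗_{A0} V = (A ⊗_{A0} A) ⊗_A V], and [can'] is linear for the right action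
    of A on the second factor, so [gal'] is [can' ⊗_A V]. Concretely, its inverse is
    [v ⊗ h |-> G (1 ⊗ h) v], where [G] is the inverse of [can']. *)
Lemma gal'_bij (V : lmodType k) (la : A -> V -> V) :
  left_module la -> bijective (@gal' k H A V la).
Proof.
move=> hla; have [lal lar la1 laA] := hla.
have hA := hm_module (regular_hopf_module A).
have [G canK GK] := can'_bij.
have cD : {morph @can' k H A : s t / s + t} := gal'D hA.
have GD : {morph G : s t / s + t}.
  by move=> s t; apply: (can_inj canK); rewrite cD !GK.
have Gmul (b : A) h : contract (fun a b : A => a * b) b (G (1 ⊗ h)) = G (b ⊗ h).
  apply: (can_inj canK); rewrite GK.
  rewrite [LHS](gal'_contract hA) GK klift_kpair ?mul1r //; lin.
have cA v b h : contract la (la b v) (G (1 ⊗ h)) = contract la v (G (b ⊗ h)).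
  rewrite -Gmul; set t := G _.
  transitivity (tlift (fun a c => contract la v (tpair _ _ a (c * b))) t).
    by apply: eq_tlift => a c; rewrite contract_pair // laA.
  exact/esym/(tlift_comp _ t (contractD hla v)).
pose inv (t : ktens V H) : Atensor la := tlift (fun v h => contract la v (G (1 ⊗ h))) t.
have invb : balanced (fun (c : k) (v : V) => c *: v) (fun (c : k) (h : H) => c *: h)
    (fun v h => contract la v (G (1 ⊗ h))).
  split=> [v v' h|v h h'|c v h].
  - exact: contractDl.
  - by rewrite (linear_additive (kpair_linearr _)) GD contractD.
  - rewrite -kpair_scale -(cA v (c *: 1)) (linear_scale _ _ (lal v)).
    by rewrite la1.
have invD : {morph inv : s t / s + t} := tliftD invb.
have invE v h : inv (v ⊗ h) = contract la v (G (1 ⊗ h)) := tlift_tpair invb v h.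
exists inv.
- apply: tens_ext => [s t|//|a v]; first by rewrite gal'D // invD.
  rewrite gal'_pair // /klift (tlift_comp _ _ invD).
  transitivity (tlift (fun a0 a1 => contract la v (G (a0 ⊗ a1))) (rho a)).
    by apply: eq_tlift => a0 a1; rewrite invE cA.
  rewrite -(tlift_comp (F := fun t => contract la v (G t)) _ (rho a)); last first.
    by move=> s t; rewrite GD contractD.
  have -> : tlift (fun a0 a1 => a0 ⊗ a1) (rho a) = can' (tpair _ _ a 1).
    rewrite [RHS](gal'_pair hA); apply: eq_tlift => a0 a1.
    by rewrite mulr1.
  by rewrite canK contract_pair // la1.
- apply: tens_ext => [s t|//|v h]; first by rewrite invD gal'D.
  rewrite [inv _]invE gal'_contract // GK klift_kpair ?la1 //; lin.
Qed.

Lemma gal_inj (V : lmodType k) (la : A -> V -> V) (r : V -> ktens V H) :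
  hopf_module la r -> injective (gal r : Atensor la -> ktens V H).
Proof.
move=> hV s t st; apply: (bij_inj (gal'_bij (hm_module hV))).
by rewrite -!(twist_gal hV) st.
Qed.

(** [can' = twist \o can], and [twist (1 ⊗ h) = 1 ⊗ S(h)]. Injectivity of [twist]
    shows at the same time that [1 ⊗ h] is in the image of [can], so that
    [transl A h] is not the default value. *)
Lemma can'_transl (h : H) : bijective (antipode : H -> H) ->
  can' (transl A h) = 1 ⊗ antipode h.
Proof.
move=> Sbij; have hA := regular_hopf_module A.
have canE t : twist (@rho k H A) (can t) = can' t := twist_gal hA t.
have t1 g : twist (@rho k H A) (1 ⊗ g) = 1 ⊗ antipode g.
  by rewrite (twist_kpair hA) rho_1 klift_kpair ?mul1r //; lin.
have [G canK GK] := can'_bij.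
have : exists t : Atens A, can t = 1 ⊗ h.
  exists (G (1 ⊗ antipode h)); apply: (twist_inj hA Sbij).
  by rewrite canE GK t1.
by move=> /(@xgetPex _ (0 : Atens A)) /= th; rewrite -canE th t1.
Qed.

End GaloisBijectivity.

(** * The structure theorem [A ⊗_{A0} M0 = M] *)

Section Structure.
Variables (k : comPzRingType) (H : hopfType k) (A : comodAlgType H).

(** V as a module over the coinvariants of A. The proof of the module axioms is
    an argument so that it can be found when the structure is inferred. *)
Definition resmod (V : lmodType k) (la : A -> V -> V) (hla : left_module la) : Type := V.

Section Resmod.
Variables (V : lmodType k) (la : A -> V -> V) (hla : left_module la).
HB.instance Definition _ := GRing.Zmodule.on (resmod hla).

Fact resmodA a b (v : resmod hla) :
  coinv_act la a (coinv_act la b v) = coinv_act la (a * b) v.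
Proof. exact: (lm_A hla). Qed.

Fact resmod1 : left_id 1 (coinv_act la : coinv_ring A -> resmod hla -> resmod hla).
Proof. exact: (lm_1 hla). Qed.

Fact resmodDr :
  right_distributive (coinv_act la : coinv_ring A -> resmod hla -> resmod hla) +%R.
Proof. by move=> a; apply: (linear_additive (lm_linearr hla (val a))). Qed.

Fact resmodDl (v : resmod hla) :
  {morph (coinv_act la : coinv_ring A -> resmod hla -> resmod hla)^~ v : a b / a + b}.
Proof. by move=> a b; apply: (linear_additive (lm_linearl hla v)). Qed.

HB.instance Definition _ := GRing.Zmodule_isLmodule.Build (coinv_ring A) (resmod hla)
  resmodA resmod1 resmodDr resmodDl.
End Resmod.

Variables (B : comodAlgType H) (M : hbimodType A B).
Let hM := hbimod_hopf_module M.
Let hMH := tensH_hopf_module hM.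
Local Notation lact := (@lact k H A B M).
Local Notation M_ := (resmod (hm_module hM)).
Local Notation MH_ := (resmod (hm_module hMH)).

Definition coinv_incl (m : coinv M) : M_ := val m.

Fact coinv_incl_linear : linear coinv_incl.
Proof. by move=> a m n. Qed.

HB.instance Definition _ := GRing.isLinear.Build (coinv_ring A) (coinv M) M_ _
  coinv_incl coinv_incl_linear.

(** The kernel of this map is M0; it is linear over A0, though not over A. *)
Definition coinv_defect (m : M_) : MH_ := rho (m : M) - (m : M) ⊗ 1.

Fact coinv_defect_linear : linear coinv_defect.
Proof.
move=> a m n; rewrite /coinv_defect.
have E : rho ((a *: m : M_) : M) = a *: (rho (m : M) : MH_).
  exact: (rho_coinv_act hM).
have F : ((a *: m : M_) : M) ⊗ (1 : H) = a *: ((m : M) ⊗ 1 : MH_).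
  have [lal lar _ _] := hm_module hM.
  by rewrite [RHS](klift_kpair (g := fun v h => lact (val a) v ⊗ h)) //; lin.
rewrite (rhoD (a *: m : M_)) E (linear_additive (kpair_linearl (1 : H))) F.
rewrite opprD addrACA; congr (_ + _).
by rewrite scalerBr.
Qed.

HB.instance Definition _ := GRing.isLinear.Build (coinv_ring A) M_ MH_ _
  coinv_defect coinv_defect_linear.

Definition Acoinv : zmodType := tens_mod (@coinv_rmul k H A) (coinv M).

Definition coinv_mul (t : Acoinv) : M := tlift (fun a m => lact a (val m)) t.

Lemma coinv_mul_balanced : balanced (@coinv_rmul k H A)
  (fun (r : coinv_ring A) (m : coinv M) => r *: m) (fun a m => lact a (val m)).
Proof.
have [lal lar la1 laA] := hm_module hM.
split=> [a a' m|a m m'|b a m].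
- exact: (linear_additive (lal _)).
- exact: (linear_additive (lar a)).
- by rewrite /coinv_rmul -laA.
Qed.

Lemma coinv_mulD : {morph coinv_mul : s t / s + t}.
Proof. exact: (tliftD coinv_mul_balanced). Qed.

Lemma coinv_mul_pair a m : coinv_mul (tpair _ _ a m) = lact a (val m).
Proof. exact: (tlift_tpair coinv_mul_balanced). Qed.

Lemma coinv_mul0 : coinv_mul 0 = 0.
Proof. exact: (additive0 coinv_mulD). Qed.

Definition incl_map : Acoinv -> Atensor lact :=
  @tens_map _ _ (@coinv_rmul k H A) _ _ coinv_incl.

Lemma incl_map_balanced : balanced (@coinv_rmul k H A)
  (fun (r : coinv_ring A) (m : coinv M) => r *: m)
  (fun a m => apair lact a (val m)).
Proof.
split=> [a a' m|a m m'|b a m]; [exact: tpairDl|exact: tpairDr|exact: tpair_bal].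
Qed.

Lemma incl_mapD : {morph incl_map : s t / s + t}.
Proof. exact: (tliftD incl_map_balanced). Qed.

Lemma incl_map_pair a m : incl_map (tpair _ _ a m) = apair lact a (val m).
Proof. exact: (tlift_tpair incl_map_balanced). Qed.

(** Multiplication by a is [rho]-compatible, so on coinvariant [m] the expression
    [a_0 m ⊗ a_1] is [rho (a m)]. *)
Lemma gal'_incl_map t : gal' (incl_map t) = rho (coinv_mul t).
Proof.
have hm := hm_module hM; have [lal lar la1 laA] := hm.
elim/tens_ind: t => [|a m|s t hs ht]; last 1 first.
- by rewrite incl_mapD gal'D // hs ht coinv_mulD rhoD.
- by rewrite coinv_mul0 rho0 (additive0 incl_mapD) (additive0 (gal'D hm)).
rewrite incl_map_pair gal'_pair // coinv_mul_pair (hm_rho_la hM).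
have /coinvP -> := valP m.
by apply: eq_klift => a0 a1; rewrite klift_kpair ?mulr1 //; lin.
Qed.

Lemma gal_incl_map t : gal (@rho k H M) (incl_map t) = coinv_mul t ⊗ 1.
Proof.
have hm := hm_module hM; have [lal lar la1 laA] := hm.
elim/tens_ind: t => [|a m|s t hs ht]; last 1 first.
- rewrite incl_mapD (galD hM) hs ht coinv_mulD.
  by rewrite (linear_additive (kpair_linearl _)).
- rewrite coinv_mul0 (additive0 incl_mapD) (additive0 (galD hM)).
  by rewrite (additive0 (linear_additive (kpair_linearl _))).
rewrite incl_map_pair (gal_pair hM) coinv_mul_pair.
have /coinvP -> := valP m.
by rewrite klift_kpair //; lin.
Qed.

Hypothesis can'_bij : bijective (@can' k H A).
Hypothesis A_ff : faithfully_flat (@coinv_rmul k H A).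

(** Flatness, applied to the exact sequence [0 -> M0 -> M]; its first map is the
    zero map out of M0. *)
Lemma incl_map_eq0 t : incl_map t = 0 -> t = 0.
Proof.
move=> t0.
pose z : {linear coinv M -> coinv M} := \0.
have ex : exact_at z (coinv_incl : {linear coinv M -> M_}).
  move=> m; split=> [m0|[u <-]]; last by [].
  by exists 0; apply/esym/val_inj.
have [u <-] := ((A_ff z (coinv_incl : {linear coinv M -> M_})).1 ex t).1 t0.
rewrite /tens_map /tlift big1 // => p _.
exact: (additive0 (tpairDr _ _ p.1)).
Qed.

Lemma coinv_mul_inj : injective coinv_mul.
Proof.
apply: (additive_inj coinv_mulD) => t t0; apply: incl_map_eq0.
have hm := hm_module hM.
apply: (bij_inj (gal'_bij can'_bij hm)).
by rewrite gal'_incl_map t0 rho0 (additive0 (gal'D hm)).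
Qed.

Definition coinv_defect_tens : Atensor lact -> Atensor (tensH_lact lact) :=
  @tens_map _ _ (@coinv_rmul k H A) _ _ coinv_defect.

Lemma coinv_defect_tens_balanced : balanced (@coinv_rmul k H A)
  (coinv_act lact) (fun a m => apair (tensH_lact lact) a (rho m - m ⊗ 1)).
Proof.
split=> [a a' m|a m m'|b a m]; first exact: tpairDl.
- have -> : rho (m + m') - (m + m') ⊗ (1 : H) = coinv_defect m + coinv_defect m'.
    exact: (raddfD (coinv_defect : {linear M_ -> MH_})).
  exact: apairDr.
- rewrite [LHS]apair_bal; congr (apair _ a _); apply: esym.
  exact: (linearZ_LR (coinv_defect : {linear M_ -> MH_}) b (m : M_)).
Qed.

Lemma coinv_defect_tensD : {morph coinv_defect_tens : s t / s + t}.
Proof. exact: (tliftD coinv_defect_tens_balanced). Qed.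

Lemma coinv_defect_tens_pair a m : coinv_defect_tens (apair lact a m) =
  apair (tensH_lact lact) a (rho m - m ⊗ 1).
Proof. exact: (tlift_tpair coinv_defect_tens_balanced). Qed.

(** What [coinv_defect] becomes on [M ⊗ H] once [A ⊗_{A0} M] and
    [A ⊗_{A0} (M ⊗ H)] are replaced by their images under [gal]. The legs of
    [Delta h] are exchanged because the coaction of [M ⊗ H] puts its
    H-component last. *)
Definition Delta_defect (t : ktens M H) : ktens (ktens M H) H :=
  klift (fun m h => klift (fun x y => (m ⊗ y) ⊗ x) (Delta h) - (m ⊗ 1) ⊗ h) t.

Lemma Delta_defect_bilinear : bilinear2 (fun (m : M) (h : H) =>
  klift (fun x y => (m ⊗ y) ⊗ x) (Delta h) - (m ⊗ 1) ⊗ h).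
Proof. by split=> x; apply: linear_sub; lin. Qed.

Lemma gal_coinv_defect t :
  gal (tensH_rho (@rho k H M)) (coinv_defect_tens t) =
  Delta_defect (gal (@rho k H M) t).
Proof.
have [[lal lar la1 laA] rl coas coun rla] := hM.
have DD := linear_additive (klift_linear Delta_defect_bilinear).
have {}DD : {morph Delta_defect : x y / x + y} := DD.
elim/Atensor_ind: t => [|a m|s t hs ht]; last 1 first.
- by rewrite coinv_defect_tensD (galD hMH) hs ht (galD hM) DD.
- by rewrite (additive0 coinv_defect_tensD) (additive0 (galD hMH))
    (additive0 (galD hM)) (additive0 DD).
rewrite coinv_defect_tens_pair (gal_pair hMH) (gal_pair hM).
pose L v := klift (fun v0 v1 => tensH_lact lact a v0 ⊗ v1)
  (tensH_rho (@rho k H M) v).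
have Ll : linear L.
  have [[_ lar' _ _] rl' _ _ _] := hMH; rewrite /L; lin.
have LE n h : L (n ⊗ h) = klift (fun v0 v1 => (lact a v0 ⊗ h) ⊗ v1) (rho n).
  have [[_ lar' _ _] rl' _ _ _] := hMH.
  rewrite /L /tensH_rho klift_kpair; last by lin.
  rewrite klift_klift; last by lin.
  apply: eq_klift => x y; rewrite klift_kpair; last by lin.
  by rewrite /tensH_lact klift_kpair //; lin.
rewrite -/(L _) (linear_additive Ll) (additiveN (linear_additive Ll)) LE.
rewrite -[X in L X]klift_id (klift_comp _ _ Ll).
transitivity (klift (fun m0 m1 =>
      klift (fun x y => (lact a x ⊗ m1) ⊗ y) (rho m0)) (rho m)
   - klift (fun v0 v1 => (lact a v0 ⊗ 1) ⊗ v1) (rho m)).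
  by congr (_ - _); apply: eq_klift => x y; rewrite LE.
rewrite (rho_coassocE (g := fun x y z => (lact a x ⊗ z) ⊗ y)); last by lin.
rewrite /Delta_defect klift_klift; last exact: Delta_defect_bilinear.
rewrite -klift_sub; apply: eq_klift => x y.
by rewrite klift_kpair //; exact: Delta_defect_bilinear.
Qed.

Hypothesis antipode_bij : bijective (antipode : H -> H).

(** Given m, let [t] be the element of [A ⊗_{A0} M] with [gal t = m ⊗ 1]. Since
    [Delta 1 = 1 ⊗ 1], the map [A ⊗ coinv_defect] kills [t], so by flatness [t]
    comes from [A ⊗_{A0} M0]; [gal_incl_map] then identifies its product with m. *)
Lemma coinv_mul_surj m : exists t, coinv_mul t = m.
Proof.
have hm := hm_module hM; have [lal lar la1 laA] := hm.
have [G canK GK] := gal'_bij can'_bij hm.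
pose t := G (rho m).
(* [gal' t = rho m = twist (m ⊗ 1)] *)
have tE : gal (@rho k H M) t = m ⊗ 1.
  by apply: (twist_inj hM antipode_bij); rewrite (twist_gal hM) GK (twist_coinv hM).
have ex : exact_at (coinv_incl : {linear coinv M -> M_})
    (coinv_defect : {linear M_ -> MH_}).
  move=> n; split=> [n0|[u <-]].
    have hn : (n : M) \in is_coinv M by apply/coinvP/eqP; rewrite -subr_eq0; apply/eqP.
    by exists (Sub (n : M) hn); exact: SubK.
  by rewrite /= /coinv_defect; have /coinvP -> := valP u; rewrite subrr.
have t0 : coinv_defect_tens t = 0.
  apply: (gal_inj can'_bij hMH); rewrite gal_coinv_defect tE (additive0 (galD hMH)).
  rewrite /Delta_defect klift_kpair; last exact: Delta_defect_bilinear.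
  by rewrite Delta_1 klift_kpair ?subrr //; lin.
have [s sE] := ((A_ff (coinv_incl : {linear coinv M -> M_})
  (coinv_defect : {linear M_ -> MH_})).1 ex t).1 t0.
exists s; have : coinv_mul s ⊗ (1 : H) = m ⊗ 1.
  by rewrite -gal_incl_map -tE -sE.
move/(congr1 (klift (fun v h => counit h *: v))).
by rewrite !klift_kpair ?counit_1 ?scale1r //; lin.
Qed.

Theorem coinv_mul_bij : bijective coinv_mul.
Proof.
exists (fun m => projT1 (cid (coinv_mul_surj m))) => [t|m]; last first.
  by case: cid.
by apply: coinv_mul_inj; case: cid.
Qed.

End Structure.

(** * Induction from A to B through M *)

Section Induction.
Variables (k : comPzRingType) (H : hopfType k) (A B : comodAlgType H).
Variable M : hbimodType A B.
Local Notation lactM := (@lact k H A B M).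
Let hM := hbimod_hopf_module M.
Let hm := hm_module hM.

Lemma ract_linl (b : B) : linear (fun m : M => ract m b).
Proof. by move=> c m m'; apply: ract_linearl. Qed.

Lemma ract_linr (m : M) : linear (fun b : B => ract m b).
Proof. by move=> c b b'; apply: ract_linearr. Qed.

Lemma rmulA (X : lmodType A^c) (x : X) (a b : A) :
  rmul (rmul x a) b = rmul x (a * b).
Proof. exact: scalerA. Qed.

Lemma rmul1 (X : lmodType A^c) (x : X) : rmul x 1 = x.
Proof. exact: scale1r. Qed.

Lemma rmulDr (X : lmodType A^c) (x : X) (a b : A) :
  rmul x (a + b) = rmul x a + rmul x b.
Proof. exact: scalerDl. Qed.

Lemma rmulDl (X : lmodType A^c) (x y : X) (a : A) :
  rmul (x + y) a = rmul x a + rmul y a.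
Proof. exact: scalerDr. Qed.

Lemma coinv_ract_mem (m : coinv M) (b : coinv_ring B) :
  ract (val m) (val b) \in is_coinv M.
Proof.
have /coinvP hb := valP b; have /coinvP hmm := valP m; apply/coinvP.
rewrite rho_ract hb hmm tmap2_kpair ?mulr1 //; move=> *;
  by rewrite ?mulr_linl ?mulr_linr ?ract_linearl ?ract_linearr.
Qed.

Definition coinv_ract (m : coinv M) (b : coinv_ring B) : coinv M :=
  Sub (ract (val m) (val b)) (coinv_ract_mem m b).

Section Object.
Variable X : lmodType A^c.
Local Notation iota := (@indco_to_indA k H A B M X).

Definition ipair (x : X) (m : M) : indA M X := tpair _ _ x m.
Definition copair (x : X) (m : coinv M) : indco M X := tpair _ _ x m.

Lemma ipairDl x y (m : M) : ipair (x + y) m = ipair x m + ipair y m.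
Proof. exact: tpairDl. Qed.
Lemma ipairDr x (m n : M) : ipair x (m + n) = ipair x m + ipair x n.
Proof. exact: tpairDr. Qed.
Lemma ipair_bal x a (m : M) : ipair (rmul x a) m = ipair x (lact a m).
Proof. exact: tpair_bal. Qed.
Lemma copairDl x y m : copair (x + y) m = copair x m + copair y m.
Proof. exact: tpairDl. Qed.
Lemma copairDr x m n : copair x (m + n) = copair x m + copair x n.
Proof. exact: tpairDr. Qed.
Lemma copair_bal x (a : coinv_ring A) m :
  copair (rmul x (val a)) m = copair x (a *: m).
Proof. exact: tpair_bal. Qed.

Lemma iota_balanced : balanced (fun (a : coinv_ring A) (x : X) => rmul x (val a))
  (fun (a : coinv_ring A) (m : coinv M) => a *: m) (fun x m => ipair x (val m)).
Proof.
split=> [x x' y|x y y'|a x y]; [exact: ipairDl|exact: ipairDr|exact: ipair_bal].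
Qed.

Lemma iotaD : {morph iota : s t / s + t}.
Proof. exact: (tliftD iota_balanced). Qed.

Lemma iota_pair x m : iota (copair x m) = ipair x (val m).
Proof. exact: (tlift_tpair iota_balanced). Qed.

Lemma indA_ract_balanced (b : B) : balanced (fun (a : A) (x : X) => rmul x a)
  (fun (a : A) (m : M) => lact a m) (fun x m => ipair x (ract m b)).
Proof.
split=> [x x' m|x m m'|a x m]; first exact: ipairDl.
- by rewrite (linear_additive (ract_linl b)) ipairDr.
- by rewrite ipair_bal lractA.
Qed.

Lemma indA_ractD b : {morph (@indA_ract k H A B M X)^~ b : s t / s + t}.
Proof. exact: (tliftD (indA_ract_balanced b)). Qed.

Lemma indA_ract_pair b x m : indA_ract (ipair x m) b = ipair x (ract m b).
Proof. exact: (tlift_tpair (indA_ract_balanced b)). Qed.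

(** [a ⊗ m |-> x a ⊗ m]: how [A ⊗_{A0} M0] describes elements [x ⊗ m b] of
    [X ⊗_{A0} M0]. *)
Definition co_act (x : X) (s : Acoinv M) : indco M X :=
  tlift (fun a m => copair (rmul x a) m) s.

Lemma co_act_balanced x : balanced (@coinv_rmul k H A)
  (fun (r : coinv_ring A) (m : coinv M) => r *: m)
  (fun a m => copair (rmul x a) m).
Proof.
split=> [a a' m|a m m'|b a m]; last 1 first.
- by rewrite /coinv_rmul -rmulA copair_bal.
- by rewrite rmulDr copairDl.
- exact: copairDr.
Qed.

Lemma co_actD x : {morph co_act x : s t / s + t}.
Proof. exact: (tliftD (co_act_balanced x)). Qed.

Lemma co_act_pair x a m : co_act x (tpair _ _ a m) = copair (rmul x a) m.
Proof. exact: (tlift_tpair (co_act_balanced x)). Qed.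

Lemma iota_co_act x s : iota (co_act x s) = ipair x (coinv_mul s).
Proof.
apply: (tens_ext (F := fun s => iota (co_act x s))
                 (G := fun s => ipair x (coinv_mul s))) => [u v|u v|a m].
- by rewrite co_actD iotaD.
- by rewrite coinv_mulD ipairDr.
- by rewrite co_act_pair iota_pair coinv_mul_pair ipair_bal.
Qed.

Hypothesis mul_bij : bijective (@coinv_mul k H A B M).

Lemma iota_surj t : exists s, iota s = t.
Proof.
have [c _ cK] := mul_bij.
elim/tens_ind: t => [|x m|s t [s' <-] [t' <-]].
- by exists 0; rewrite (additive0 iotaD).
- by exists (co_act x (c m)); rewrite iota_co_act cK.
- by exists (s' + t'); rewrite iotaD.
Qed.

Definition Acoinv_lact (a : A) (s : Acoinv M) : Acoinv M :=
  tlift (fun a' m => tpair _ _ (a * a') m) s.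

Lemma Acoinv_lact_balanced a : balanced (@coinv_rmul k H A)
  (fun (r : coinv_ring A) (m : coinv M) => r *: m)
  (fun a' m => tpair (@coinv_rmul k H A)
    (fun (r : coinv_ring A) (m : coinv M) => r *: m) (a * a') m).
Proof.
split=> [b b' m|b m m'|b a' m]; last 1 first.
- by rewrite -tpair_bal /coinv_rmul mulrA.
- by rewrite mulrDr tpairDl.
- exact: tpairDr.
Qed.

Lemma Acoinv_lactD a : {morph Acoinv_lact a : s t / s + t}.
Proof. exact: (tliftD (Acoinv_lact_balanced a)). Qed.

Lemma Acoinv_lact_pair a a' m :
  Acoinv_lact a (tpair _ _ a' m) = tpair _ _ (a * a') m.
Proof. exact: (tlift_tpair (Acoinv_lact_balanced a)). Qed.

Lemma coinv_mul_lact a s : coinv_mul (Acoinv_lact a s) = lact a (coinv_mul s).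
Proof.
have lD := linear_additive (lm_linearr hm a).
apply: (tens_ext (F := fun s => coinv_mul (Acoinv_lact a s))
                 (G := fun s => lact a (coinv_mul s))) => [u v|u v|a' m].
- by rewrite Acoinv_lactD coinv_mulD.
- by rewrite coinv_mulD lD.
- by rewrite Acoinv_lact_pair !coinv_mul_pair lactA.
Qed.

Lemma co_act_lact x a s : co_act (rmul x a) s = co_act x (Acoinv_lact a s).
Proof.
apply: (tens_ext (F := co_act (rmul x a))
                 (G := fun s => co_act x (Acoinv_lact a s))) => [u v|u v|a' m].
- exact: co_actD.
- by rewrite Acoinv_lactD co_actD.
- by rewrite Acoinv_lact_pair !co_act_pair rmulA.
Qed.

(** The retraction is [x ⊗ m |-> \sum_i x a_i ⊗ m_i], where [\sum_i a_i ⊗ m_i] is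
    the preimage of m in [A ⊗_{A0} M0]. *)
Lemma iota_inj : injective iota.
Proof.
have [c canK cK] := mul_bij.
pose ret (t : indA M X) : indco M X := tlift (fun x m => co_act x (c m)) t.
have cD : {morph c : m n / m + n}.
  by move=> m n; apply: (can_inj canK); rewrite coinv_mulD !cK.
have bal : balanced (fun (a : A) (x : X) => rmul x a)
    (fun (a : A) (m : M) => lact a m) (fun x m => co_act x (c m)).
  split=> [x x' m|x m m'|a x m].
  - rewrite -tlift_add; apply: eq_tlift => a n.
    by rewrite rmulDl copairDl.
  - by rewrite cD co_actD.
  - rewrite co_act_lact; congr co_act; apply: (can_inj canK).
    by rewrite coinv_mul_lact !cK.
have retD : {morph ret : s t / s + t} := tliftD bal.
apply: (can_inj (g := ret)).
apply: (tens_ext (F := fun t => ret (iota t)) (G := id)) => [s t|//|x m].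
  by rewrite iotaD retD.
rewrite [iota _]iota_pair [LHS](tlift_tpair bal).
have -> : c (val m) = tpair _ _ 1 m.
  by apply: (can_inj canK); rewrite cK coinv_mul_pair lact1.
by rewrite co_act_pair rmul1.
Qed.

Lemma iota_ract t b : iota (indco_ract t b) = indA_ract (iota t) b.
Proof.
exact: (@xgetPex _ (0 : indco M X) [set s | iota s = indA_ract (iota t) b]%classic
  (iota_surj _)).
Qed.

Lemma indco_ractD b : {morph (@indco_ract k H A B M X)^~ b : s t / s + t}.
Proof.
by move=> s t; apply: iota_inj; rewrite iotaD !iota_ract iotaD indA_ractD.
Qed.

Lemma indco_ract_pair x m s b : coinv_mul s = ract (val m) b ->
  indco_ract (copair x m) b = co_act x s.
Proof.
by move=> sE; apply: iota_inj; rewrite iota_ract iota_pair indA_ract_pair iota_co_act sE.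
Qed.

Lemma indco_ract_coinv x m (b : coinv_ring B) :
  indco_ract (copair x m) (val b) = copair x (coinv_ract m b).
Proof.
by apply: iota_inj; rewrite iota_ract !iota_pair indA_ract_pair.
Qed.

End Object.

Section Maps.
Variables (X Y : lmodType A^c) (f : X -> Y).
Hypothesis f_hom : coinv_hom (@rmul A X) (@rmul A Y) f.

Lemma indco_map_balanced : balanced (fun (a : coinv_ring A) (x : X) => rmul x (val a))
  (fun (a : coinv_ring A) (m : coinv M) => a *: m) (fun x m => copair (f x) m).
Proof.
have [fD fA] := f_hom.
split=> [x x' m|x m m'|a x m]; last 1 first.
- by rewrite fA copair_bal.
- by rewrite fD copairDl.
- exact: copairDr.
Qed.

Lemma indco_mapD : {morph indco_map M f : s t / s + t}.
Proof. exact: (tliftD indco_map_balanced). Qed.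

Lemma indco_map_pair x m : indco_map M f (copair x m) = copair (f x) m.
Proof. exact: (tlift_tpair indco_map_balanced). Qed.

Definition map_act (x : X) (t : Atensor lactM) : indA M Y :=
  tlift (fun a m => ipair (f (rmul x a)) m) t.

Lemma map_act_balanced x : balanced (@coinv_rmul k H A) (coinv_act lactM)
  (fun a m => ipair (f (rmul x a)) m).
Proof.
have [fD fA] := f_hom.
split=> [a a' m|a m m'|b a m]; last 1 first.
- by rewrite /coinv_rmul -rmulA fA ipair_bal.
- by rewrite rmulDr fD ipairDl.
- exact: ipairDr.
Qed.

Lemma map_actD x : {morph map_act x : s t / s + t}.
Proof. exact: (tliftD (map_act_balanced x)). Qed.

Lemma map_act_pair x a m : map_act x (apair lactM a m) = ipair (f (rmul x a)) m.
Proof. exact: (tlift_tpair (map_act_balanced x)). Qed.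

Lemma iota_map_co_act x s :
  indco_to_indA (indco_map M f (co_act x s)) = map_act x (incl_map s).
Proof.
apply: (tens_ext (F := fun s => indco_to_indA (indco_map M f (co_act x s)))
                 (G := fun s => map_act x (incl_map s))) => [u v|u v|a m].
- by rewrite co_actD indco_mapD iotaD.
- by rewrite incl_mapD map_actD.
- by rewrite co_act_pair indco_map_pair iota_pair incl_map_pair map_act_pair.
Qed.

Definition Atensor_ract (t : Atensor lactM) (b : B) : Atensor lactM :=
  tlift (fun a m => apair lactM a (ract m b)) t.

Lemma Atensor_ract_balanced b : balanced (@coinv_rmul k H A) (coinv_act lactM)
  (fun a m => apair lactM a (ract m b)).
Proof.
split=> [a a' m|a m m'|c a m]; first exact: apairDl.
- by rewrite (linear_additive (ract_linl b)) apairDr.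
- by rewrite apair_bal lractA.
Qed.

Lemma Atensor_ractD b : {morph Atensor_ract^~ b : s t / s + t}.
Proof. exact: (tliftD (Atensor_ract_balanced b)). Qed.

Lemma Atensor_ract_pair b a m : Atensor_ract (apair _ a m) b = apair _ a (ract m b).
Proof. exact: (tlift_tpair (Atensor_ract_balanced b)). Qed.

Lemma map_act_ract x t b : indA_ract (map_act x t) b = map_act x (Atensor_ract t b).
Proof.
apply: (tens_ext (F := fun t => indA_ract (map_act x t) b)
                 (G := fun t => map_act x (Atensor_ract t b))) => [u v|u v|a m].
- by rewrite map_actD indA_ractD.
- by rewrite Atensor_ractD map_actD.
- by rewrite map_act_pair indA_ract_pair Atensor_ract_pair map_act_pair.
Qed.

Lemma gal'_ract t b :
  gal' (Atensor_ract t b) = klift (fun v h => ract v b ⊗ h) (gal' t).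
Proof.
have [lal lar la1 laA] := hm; have rl := ract_linl b.
have bl : bilinear2 (fun (v : M) (h : H) => ract v b ⊗ h) by lin.
apply: (tens_ext (F := fun t => gal' (Atensor_ract t b))
                 (G := fun t => klift (fun v h => ract v b ⊗ h) (gal' t)))
   => [u v|u v|a m].
- by rewrite Atensor_ractD gal'D.
- by rewrite gal'D // (linear_additive (klift_linear bl)).
rewrite Atensor_ract_pair !gal'_pair // klift_klift //.
by apply: eq_klift => a0 a1; rewrite klift_kpair // lractA.
Qed.

Lemma rho_ract_coinv (m : coinv M) (b : B) :
  rho (ract (val m) b) = klift (fun b0 b1 => ract (val m) b0 ⊗ b1) (rho b).
Proof.
have E : rho (ract (val m) b) = klift (fun m0 m1 =>
  klift (fun b0 b1 => ract m0 b0 ⊗ (m1 * b1)) (rho b)) (rho (val m)) := rho_ract _ _.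
have /coinvP vm := valP m; rewrite E vm klift_kpair.
  by apply: eq_klift => b0 b1; rewrite mul1r.
have rl := ract_linl; lin.
Qed.

Hypothesis mul_bij : bijective (@coinv_mul k H A B M).

Lemma indco_map_hom :
  coinv_hom (@indco_ract k H A B M X) (@indco_ract k H A B M Y) (indco_map M f).
Proof.
split; first exact: indco_mapD.
move=> b t.
apply: (tens_ext (F := fun t => indco_map M f (indco_ract t (val b)))
                 (G := fun t => indco_ract (indco_map M f t) (val b)))
   => [u v|u v|x m].
- by rewrite indco_ractD // indco_mapD.
- by rewrite indco_mapD indco_ractD.
- by rewrite indco_ract_coinv // !indco_map_pair indco_ract_coinv.
Qed.

Hypothesis antipode_bij : bijective (antipode : H -> H).
Hypothesis canA_bij : bijective (@can' k H A).
Hypothesis canB_bij : bijective (@can' k H B).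

(** Both sides have image [m ⊗ S(h)] under the injective map [gal']. On the left,
    [c (m l)] multiplies to [m l], whose coaction is [m l_0 ⊗ l_1], so that [gal']
    gives [m (l_0 r) ⊗ l_1]: this is [can' (l ⊗ r)] for B, acting on m. *)
Lemma transl_exchange (c : M -> Acoinv M) : cancel c (@coinv_mul k H A B M) ->
  forall (m : coinv M) (h : H),
  tlift (fun l r => Atensor_ract (incl_map (c (ract (val m) l))) r) (transl B h) =
  contract lactM (val m) (transl A h).
Proof.
move=> cK m h; have [lal lar la1 laA] := hm.
have rr := ract_linr (val m).
apply: (bij_inj (gal'_bij canA_bij hm)).
rewrite gal'_contract // can'_transl // klift_kpair; last by lin.
rewrite lact1 (tlift_comp _ _ (gal'D hm)).
pose P (t : ktens B H) : ktens M H := klift (fun b g => ract (val m) b ⊗ g) t.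
have Pb : bilinear2 (fun (b : B) (g : H) => ract (val m) b ⊗ g) by lin.
have PD : {morph P : s t / s + t} := linear_additive (klift_linear Pb).
transitivity (P (can' (transl B h))); last first.
  by rewrite can'_transl // /P klift_kpair ?ract1.
rewrite /can' (tlift_comp _ _ PD); apply: eq_tlift => l r.
have rl := ract_linl r.
rewrite gal'_ract gal'_incl_map cK rho_ract_coinv klift_klift; last by lin.
rewrite [RHS](klift_klift Pb (fun a0 a1 => (a0 * r) ⊗ a1)).
apply: eq_klift => b0 b1; rewrite !klift_kpair ?ractA //; lin.
Qed.

(** The two sides are compared on the pure tensors of one chosen expression of
    the argument: the right side is by definition the sum over that expression,
    and the left side is additive. *)
Lemma MU_indco_map (h : H) :
  MU (@indco_ract k H A B M X) (@indco_ract k H A B M Y) (indco_map M f) h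
  = indco_map M (MU (@rmul A X) (@rmul A Y) f h).
Proof.
have [c canK cK] := mul_bij.
apply/funext => t; set F := MU _ _ _ h.
have FD : {morph F : s t / s + t}.
  move=> u v; rewrite /F /MU -tlift_add; apply: eq_tlift => l r.
  by rewrite indco_ractD // indco_mapD indco_ractD.
rewrite -[in LHS](tlift_id t) (tlift_comp _ _ FD); apply: eq_tlift => x m.
apply: (iota_inj mul_bij); rewrite /F /MU (tlift_comp _ _ (@iotaD Y)).
transitivity (map_act x (contract lactM (val m) (transl A h))).
  rewrite -(transl_exchange cK) (tlift_comp _ _ (map_actD x)).
  apply: eq_tlift => l r; rewrite iota_ract // -map_act_ract; congr indA_ract.
  rewrite -iota_map_co_act; congr (indco_to_indA (indco_map M f _)).
  by apply: indco_ract_pair; rewrite // cK.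
rewrite [RHS]iota_pair /contract (tlift_comp _ _ (map_actD x)).
have iD : {morph (fun y : Y => ipair y (val m)) : y z / y + z}.
  by move=> y z; apply: ipairDl.
rewrite [RHS](tlift_comp (F := fun y => ipair y (val m)) _ _ iD).
by apply: eq_tlift => l r; rewrite map_act_pair ipair_bal.
Qed.

End Maps.
End Induction.

Theorem proposition6p3 (k : comPzRingType) (H : hopfType k)
    (A B : comodAlgType H) (M : hbimodType A B) (N : hbimodType B A)
    (alpha : btens M N -> A) (beta : btens N M -> B) (X Y : lmodType A^c) :
  projective_module H ->
  bijective (antipode : H -> H) ->
  right_ff_Galois A ->
  right_ff_Galois B ->
  is_strict_HMorita alpha beta ->
  forall f : X -> Y, coinv_hom (@rmul A X) (@rmul A Y) f ->
    coinv_hom (@indco_ract k H A B M X) (@indco_ract k H A B M Y)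
      (indco_map M f) /\
    forall h : H,
      MU (@indco_ract k H A B M X) (@indco_ract k H A B M Y) (indco_map M f) h
      = indco_map M (MU (@rmul A X) (@rmul A Y) f h).
Proof.
move=> _ Sbij [Aff Abij] [_ Bbij] _ f fh.
have mul_bij := @coinv_mul_bij k H A B M Abij Aff Sbij.
by split=> [|h]; [exact: indco_map_hom|exact: MU_indco_map].
Qed.
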